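(* For $\ell\in\mathbb{Z}$ let $\omega_\ell:=\frac{3\ell^2+\ell}{2}$. For $m\in\mathbb{Z}$ and $n\ge 0$, the coefficient of $z^mq^n$ in $$(q;q)_{\infty}\sum_{k\geq 0}\frac{(z^{2};q)_k(z^{-2};q)_k\,q^k}{(-zq;q)_k(-z^{-1}q;q)_k}$$ equals $$\sum_{\substack{r,s\geq 0,\ k\in\mathbb{Z}\\0\leq \omega_k\leq n}}N\left(r,s,m-2s+2r,n-\omega_k\right)(-1)^{r+s+m+k},$$ and its value is given as follows, where $U_j=U_j(1/2)$. (i) If $n=\omega_\ell$ with $\ell\ge 0$, it equals $$\begin{cases} 0,& m<-3\ell,\\ U_1,& m=-3\ell,\\ U_{m+3\ell+1},& -3\ell<m<1,\\ U_{m+3\ell+1}+(-1)^\ell U_{m-1},& 1\le m<3\ell+1,\\ -U_1+U_{6\ell+2}+(-1)^\ell U_{3\ell},& m=3\ell+1,\\ -U_{m-3\ell}+U_{m+3\ell+1}+(-1)^\ell U_{m-1},& m>3\ell+1. \end{cases}$$ (ii) If $n=\omega_{-\ell}$ with $\ell\ge 1$, it equals $$\begin{cases} 0,& m\le -3\ell,\\ -U_1,& m=-3\ell+1,\\ -U_{m+3\ell},& -3\ell+1<m<1,\\ -U_{m+3\ell}+(-1)^\ell U_{m-1},& 1\le m<3\ell,\\ -U_{6\ell}+U_1+(-1)^\ell U_{3\ell-1},& m=3\ell,\\ -U_{m+3\ell}+U_{m-3\ell+1}+(-1)^\ell U_{m-1},& m\ge 3\ell+1. \end{cases}$$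
   Context: Notation: $(A;q)_n=\prod_{j=1}^{n}(1-Aq^{j-1})$, $(A;q)_\infty=\prod_{j\ge1}(1-Aq^{j-1})$. Series are regarded as formal power series in $q$ whose coefficients are Laurent polynomials in $z$. Chebyshev polynomials of the second kind: $U_0(x)=1$, $U_1(x)=2x$, $U_{n+1}(x)=2xU_n(x)-U_{n-1}(x)$. Overpartition pairs: an overpartition is a partition in which the first occurrence of each number may be overlined. An overpartition pair $(\lambda,\mu)$ of $n$ is a pair of (possibly empty) overpartitions whose parts sum in total to $n$. Let $\ell((\lambda,\mu))$ be the maximum of the largest parts of $\lambda$ and $\mu$ ($0$ if both are empty), $n(\lambda)$ the number of parts of $\lambda$, and $\overline{n}(\mu)$ the number of overlined parts of $\mu$. The parts of the pair are ordered so that, for each number $k$, $\overline{k}$ in $\lambda$ > $k$ in $\lambda$ > $\overline{k}$ in $\mu$ > $k$ in $\mu$; let $\chi((\lambda,\mu))=1$ if the largest part of $(\lambda,\mu)$ in this order is non-overlined and in $\mu$, and $0$ otherwise. The rank of $(\lambda,\mu)$ is $\ell((\lambda,\mu))-n(\lambda)-\overline{n}(\mu)-\chi((\lambda,\mu))$. $N(r,s,m,n)$ is the number of overpartition pairs $(\lambda,\mu)$ of $n$ with rank $m$ such that $r$ is the number of overlined parts in $\lambda$ plus the number of non-overlined parts in $\mu$, and $s$ is the number of parts in $\mu$. Equivalently (a known result of Lovejoy and Bringmann–Lovejoy–Osburn), $$\sum_{r,s,n\geq 0,\ m\in\mathbb{Z}}N(r,s,m,n)d^re^sz^mq^n=\sum_{n\geq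 0}\frac{(-1/d;q)_n(-1/e;q)_n(deq)^n}{(zq;q)_n(q/z;q)_n}.$$ *)

(* Defs.v *)
From HB Require Import structures.
From mathcomp Require Import all_boot all_order all_algebra finmap.
From mathcomp Require Import mathcomp_extra boolp classical_sets functions.
From mathcomp Require Import cardinality fsbigop.

Set Implicit Arguments.
Unset Strict Implicit.
Unset Printing Implicit Defensive.

Import Order.TTheory GRing.Theory Num.Theory.

Local Open Scope ring_scope.

Section Laurent.
Variable R : comNzRingType.

Record laurent := Laurent { lfun : {fsfun int -> R with 0} }.

HB.instance Definition _ := [isNew for lfun].
HB.instance Definition _ := [Choice of laurent by <:].

Definition zcoef (m : int) (f : laurent) : R := lfun f m.

Local Notation supp f := (finsupp (lfun f)).

Definition lmon (a : int) : laurent :=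
  Laurent [fsfun k in [fset a]%fset => 1].
Definition laurent0 : laurent := Laurent [fsfun].
Definition laurent_opp (f : laurent) :=
  Laurent [fsfun k in supp f => - zcoef k f].
Definition laurent_add (f g : laurent) :=
  Laurent [fsfun k in (supp f `|` supp g)%fset => zcoef k f + zcoef k g].
Definition laurent_mul (f g : laurent) :=
  Laurent [fsfun k in [fset (i + j)%R | i in supp f, j in supp g]%fset =>
             \sum_(i <- supp f) zcoef i f * zcoef (k - i) g].

Lemma laurentP (f g : laurent) : (forall k, zcoef k f = zcoef k g) -> f = g.
Proof.
move: f g => [f] [g] h; congr Laurent; apply/fsfunP => k; exact: h.
Qed.

Lemma zcoef_out f k : k \notin supp f -> zcoef k f = 0.
Proof. exact: fsfun_dflt. Qed.

Lemma zcoef_mon a k : zcoef k (lmon a) = (k == a)%:R.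
Proof. by rewrite /zcoef fsfunE inE; case: eqP. Qed.

Lemma zcoef_0 k : zcoef k laurent0 = 0.
Proof. by rewrite /zcoef fsfunE. Qed.

Lemma zcoef_opp f k : zcoef k (laurent_opp f) = - zcoef k f.
Proof.
rewrite {1}/zcoef fsfunE; case: ifPn => // /zcoef_out ->; by rewrite oppr0.
Qed.

Lemma zcoef_add f g k : zcoef k (laurent_add f g) = zcoef k f + zcoef k g.
Proof.
rewrite {1}/zcoef fsfunE inE; case: ifPn => // /norP[h1 h2].
by rewrite !zcoef_out ?addr0.
Qed.

Lemma zcoef_mul f g k :
  zcoef k (laurent_mul f g) = \sum_(i <- supp f) zcoef i f * zcoef (k - i) g.
Proof.
rewrite {1}/zcoef fsfunE; case: ifPn => // hk.
rewrite big_seq big1 // => i hi; case: (boolP (k - i \in supp g)) => hj.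
  by case/negP: hk; apply/imfset2P; exists i => //; exists (k - i) => //; rewrite addrC subrK.
by rewrite (zcoef_out hj) mulr0.
Qed.

Lemma sum_supp (S1 S2 : seq int) (F : int -> R) : uniq S1 -> uniq S2 ->
  (forall x, F x != 0 -> (x \in S1) = (x \in S2)) ->
  \sum_(i <- S1) F i = \sum_(i <- S2) F i.
Proof.
move=> u1 u2 h.
rewrite (bigID (fun i => F i != 0)) /= [in RHS](bigID (fun i => F i != 0)) /=.
rewrite [X in _ + X]big1 => [|i /negPn/eqP //].
rewrite [X in _ = _ + X]big1 => [|i /negPn/eqP //].
rewrite !addr0 -big_filter -[in RHS]big_filter; apply: perm_big.
apply: uniq_perm; rewrite ?filter_uniq // => x.
by rewrite !mem_filter; case: (boolP (F x != 0)) => //= /h.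
Qed.

Lemma zcoef_mulW f g k (S : seq int) : uniq S -> {subset supp f <= S} ->
  zcoef k (laurent_mul f g) = \sum_(i <- S) zcoef i f * zcoef (k - i) g.
Proof.
move=> uS sub; rewrite zcoef_mul; apply: sum_supp => //; first exact: fset_uniq.
move=> x hx; have hf : x \in supp f.
  by apply: contraNT hx => /zcoef_out ->; rewrite mul0r.
by rewrite hf (sub _ hf).
Qed.

Fact laurent_addA : associative laurent_add.
Proof. by move=> f g h; apply/laurentP => k; rewrite !zcoef_add addrA. Qed.
Fact laurent_addC : commutative laurent_add.
Proof. by move=> f g; apply/laurentP => k; rewrite !zcoef_add addrC. Qed.
Fact laurent_add0 : left_id laurent0 laurent_add.
Proof. by move=> f; apply/laurentP => k; rewrite zcoef_add zcoef_0 add0r. Qed.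
Fact laurent_addN : left_inverse laurent0 laurent_opp laurent_add.
Proof.
by move=> f; apply/laurentP => k; rewrite zcoef_add zcoef_opp zcoef_0 addNr.
Qed.

HB.instance Definition _ := GRing.isZmodule.Build laurent
  laurent_addA laurent_addC laurent_add0 laurent_addN.

Fact laurent_mulC : commutative laurent_mul.
Proof.
move=> f g; apply/laurentP => k; rewrite zcoef_mul.
have inj : injective (fun i : int => k - i).
  by move=> i j /(congr1 (fun x => k - x)); rewrite !subKr.
rewrite (@zcoef_mulW g f k (undup (supp g ++ [seq k - i | i <- supp f]))).
- have -> : \sum_(i <- supp f) zcoef i f * zcoef (k - i) g =
     \sum_(i <- [seq k - i | i <- supp f]) zcoef i g * zcoef (k - i) f.
    by rewrite big_map; apply: eq_bigr => i _; rewrite mulrC subKr.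
  apply: sum_supp; rewrite ?undup_uniq ?map_inj_uniq ?fset_uniq // => x hx.
  rewrite mem_undup mem_cat.
  have hf : k - x \in supp f.
    by apply: contraNT hx => /zcoef_out ->; rewrite mulr0.
  have -> : x \in [seq k - i | i <- supp f]; last by rewrite orbT.
  by apply/mapP; exists (k - x) => //; rewrite subKr.
- exact: undup_uniq.
- by move=> x hx; rewrite mem_undup mem_cat hx.
Qed.

Fact laurent_mulA : associative laurent_mul.
Proof.
move=> f g h; apply/laurentP => k; rewrite zcoef_mul.
pose S := undup (supp (laurent_mul f g) ++
                 [seq i + j | i <- supp f, j <- supp g]).
rewrite (@zcoef_mulW _ _ _ S); last 2 first.
- exact: undup_uniq.
- by move=> x hx; rewrite mem_undup mem_cat hx.
under [RHS]eq_bigr => l _ do rewrite zcoef_mul mulr_suml.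
rewrite exchange_big /= !big_seq; apply: eq_bigr => i hi.
under [RHS]eq_bigr => l _ do rewrite -mulrA.
rewrite -mulr_sumr; congr (_ * _).
have inj : injective (fun l : int => l - i) by exact: addIr.
rewrite (@zcoef_mulW _ _ _ [seq l - i | l <- S]) ?map_inj_uniq ?undup_uniq //.
  by rewrite big_map; apply: eq_bigr => l _; rewrite opprB addrA subrK.
move=> j hj; apply/mapP; exists (i + j); last by rewrite addrC addKr.
by rewrite mem_undup mem_cat; apply/orP; right; apply: allpairs_f.
Qed.

Lemma supp_mon a : {subset supp (lmon a) <= [:: a]}.
Proof.
move=> x; rewrite mem_finsupp -/(zcoef x _) zcoef_mon inE.
by case: (x == a); rewrite ?eqxx.
Qed.

Lemma zcoef_monM a f k : zcoef k (laurent_mul (lmon a) f) = zcoef (k - a) f.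
Proof.
rewrite (@zcoef_mulW _ _ _ [:: a]) //; last exact: supp_mon.
by rewrite big_seq1 zcoef_mon eqxx mul1r.
Qed.

Fact laurent_mul1 : left_id (lmon 0) laurent_mul.
Proof. by move=> f; apply/laurentP => k; rewrite zcoef_monM subr0. Qed.

Fact laurent_mulDl : left_distributive laurent_mul laurent_add.
Proof.
move=> f g h; apply/laurentP => k.
rewrite laurent_mulC zcoef_add ![laurent_mul _ h]laurent_mulC !zcoef_mul.
by rewrite -big_split; apply: eq_bigr => i _; rewrite zcoef_add mulrDr.
Qed.

Fact laurent_1neq0 : lmon 0 != 0.
Proof.
apply/eqP => /(congr1 (zcoef 0)); rewrite zcoef_mon zcoef_0 => /eqP.
by rewrite oner_eq0.
Qed.

HB.instance Definition _ := GRing.Zmodule_isComNzRing.Build laurent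
  laurent_mulA laurent_mulC laurent_mul1 laurent_mulDl laurent_1neq0.

End Laurent.

Arguments lmon {R} a.

Section PowerSeries.
Variable R : comNzRingType.

Record fps := Fps { fpsfun : nat -> R }.

HB.instance Definition _ := gen_eqMixin fps.
HB.instance Definition _ := gen_choiceMixin fps.

Definition qcoef (n : nat) (f : fps) : R := fpsfun f n.

Definition fpsC (c : R) : fps := Fps (fun n => if n == 0%N then c else 0).
Definition fpsq : fps := Fps (fun n => (n == 1%N)%:R).
Definition fps_opp (f : fps) : fps := Fps (fun n => - qcoef n f).
Definition fps_add (f g : fps) : fps := Fps (fun n => qcoef n f + qcoef n g).
Definition fps_mul (f g : fps) : fps :=
  Fps (fun n => \sum_(i < n.+1) qcoef i f * qcoef (n - i) g).

Lemma fpsP (f g : fps) : (forall n, qcoef n f = qcoef n g) -> f = g.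
Proof. by move: f g => [f] [g] h; congr Fps; apply: funext => n; exact: h. Qed.

Fact fps_addA : associative fps_add.
Proof. by move=> f g h; apply/fpsP => n; rewrite /qcoef /= addrA. Qed.
Fact fps_addC : commutative fps_add.
Proof. by move=> f g; apply/fpsP => n; rewrite /qcoef /= addrC. Qed.
Fact fps_add0 : left_id (fpsC 0) fps_add.
Proof. by move=> f; apply/fpsP => n; rewrite /qcoef /= if_same add0r. Qed.
Fact fps_addN : left_inverse (fpsC 0) fps_opp fps_add.
Proof. by move=> f; apply/fpsP => n; rewrite /qcoef /= if_same addNr. Qed.

HB.instance Definition _ := GRing.isZmodule.Build fps
  fps_addA fps_addC fps_add0 fps_addN.

Definition fps_trunc (N : nat) (f : fps) : {poly R} :=
  \poly_(i < N) qcoef i f.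

Lemma fps_mul_trunc N f g n : (n < N)%N ->
  qcoef n (fps_mul f g) = (fps_trunc N f * fps_trunc N g)`_n.
Proof.
move=> hn; rewrite coefM; apply: eq_bigr => i _.
rewrite !coef_poly (leq_ltn_trans (leq_subr _ _) hn).
by rewrite (leq_ltn_trans _ hn) // -ltnS.
Qed.

Fact fps_mulC : commutative fps_mul.
Proof.
by move=> f g; apply/fpsP => n; rewrite !(@fps_mul_trunc n.+1) // mulrC.
Qed.

Fact fps_mulA : associative fps_mul.
Proof.
move=> f g h; apply/fpsP => n.
transitivity ((fps_trunc n.+1 f * fps_trunc n.+1 g * fps_trunc n.+1 h)`_n).
  rewrite -mulrA coefM; apply: eq_bigr => i _.
  by rewrite -fps_mul_trunc ?ltnS ?leq_subr // coef_poly ltn_ord.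
rewrite coefM; apply: eq_bigr => i _.
by rewrite -fps_mul_trunc // coef_poly ltnS leq_subr.
Qed.

Fact fps_mul1 : left_id (fpsC 1) fps_mul.
Proof.
move=> f; apply/fpsP => n; rewrite /qcoef /= big_ord_recl /= subn0 mul1r.
by rewrite big1 ?addr0 // => i _; rewrite /qcoef /= mul0r.
Qed.

Fact fps_mulDl : left_distributive fps_mul fps_add.
Proof.
move=> f g h; apply/fpsP => n; rewrite /qcoef /= -big_split /=.
by apply: eq_bigr => i _; rewrite -mulrDl.
Qed.

Fact fps_1neq0 : fpsC 1 != 0.
Proof. by apply/eqP => /(congr1 (qcoef 0)) /eqP; rewrite oner_eq0. Qed.

HB.instance Definition _ := GRing.Zmodule_isComNzRing.Build fps
  fps_mulA fps_mulC fps_mul1 fps_mulDl fps_1neq0.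

(* MathComp's inverse: the reciprocal series when there is one, the series
   itself otherwise; [fps_unit] below covers the series inverted here. *)
Definition fps_unitb (f : fps) : bool := `[< exists g : fps, g * f = 1 >].
Definition fps_inv (f : fps) : fps := xget f [set g | g * f = 1]%classic.

Fact fps_mulVf : {in fps_unitb, left_inverse 1 fps_inv *%R}.
Proof. by move=> f /asboolP[g hg]; exact: (@xgetPex _ f [set g | g * f = 1]%classic (ex_intro _ g hg)). Qed.
Fact fps_unitP (f g : fps) : g * f = 1 -> fps_unitb f.
Proof. by move=> h; apply/asboolP; exists g. Qed.
Fact fps_inv_out : {in [predC fps_unitb], fps_inv =1 id}.
Proof.
move=> f /asboolP h; apply: xgetPN => g hg; apply: h; by exists g.
Qed.

HB.instance Definition _ := GRing.ComNzRing_hasMulInverse.Build fps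
  fps_mulVf fps_unitP fps_inv_out.

Lemma qcoefD n (f g : fps) : qcoef n (f + g) = qcoef n f + qcoef n g.
Proof. by []. Qed.
Lemma qcoefN n (f : fps) : qcoef n (- f) = - qcoef n f.
Proof. by []. Qed.
Lemma qcoefM n (f g : fps) :
  qcoef n (f * g) = \sum_(i < n.+1) qcoef i f * qcoef (n - i) g.
Proof. by []. Qed.
Lemma qcoef1 n : qcoef n (1 : fps) = (n == 0%N)%:R.
Proof. by rewrite /qcoef /=; case: eqP. Qed.
Lemma qcoef_sum n (I : Type) (r : seq I) (F : I -> fps) :
  qcoef n (\sum_(i <- r) F i) = \sum_(i <- r) qcoef n (F i).
Proof.
by apply: (big_morph (qcoef n)) => //; rewrite /qcoef /= if_same.
Qed.

Arguments qcoef : simpl never.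

Lemma qcoef_expr_lt (f : fps) n k :
  qcoef 0 f = 0 -> (n < k)%N -> qcoef n (f ^+ k) = 0.
Proof.
move=> f0; elim: k n => // k IH n hn; rewrite exprS qcoefM big1 // => i _.
have [i0|i0] := posnP i; first by rewrite i0 f0 mul0r.
have n0 : (0 < n)%N by rewrite (leq_trans i0) // -ltnS.
by rewrite IH ?mulr0 // (@leq_trans n) // ltn_subrL i0.
Qed.

Lemma fps_unit (f : fps) : qcoef 0 f = 1 -> f \is a GRing.unit.
Proof.
move=> f0; have g0 : qcoef 0 (1 - f) = 0.
  by rewrite qcoefD qcoefN f0 qcoef1 subrr.
pose h N : fps := \sum_(k < N) (1 - f) ^+ k.
apply/unitrPr; exists (Fps (fun n => qcoef n (h n.+1))); apply/fpsP => n.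
have hst j N : (j < N)%N -> qcoef j (h N) = qcoef j (h j.+1).
  move=> hj; rewrite /h -(big_mkord xpredT (fun k => (1 - f) ^+ k)).
  rewrite (@big_cat_nat _ _ _ j.+1) //= big_mkord qcoefD.
  rewrite [X in _ + X]qcoef_sum [X in _ + X]big_nat_cond.
  rewrite [X in _ + X]big1 ?addr0 // => i.
  by rewrite andbT => /andP[hi _]; exact: qcoef_expr_lt.
transitivity (qcoef n (f * h n.+1)).
  rewrite !qcoefM; apply: eq_bigr => i _; congr (_ * _).
  by rewrite [LHS]/qcoef /= [RHS]hst // ltnS leq_subr.
have -> : f * h n.+1 = 1 - (1 - f) ^+ n.+1.
  by apply: oppr_inj; rewrite opprB subrX1 addrAC subrr add0r mulNr.
by rewrite qcoefD qcoefN qcoef_expr_lt // subr0.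
Qed.

(* Limit in the [q]-adic topology: the [n]-th coefficient is the eventual value
   of the [n]-th coefficients, or 0 if these do not stabilise. *)
Definition fps_lim (u : nat -> fps) : fps :=
  Fps (fun n => xget 0 [set c | exists K, forall k, (K <= k)%N ->
                                            qcoef n (u k) = c]%classic).

Definition fps_sum (f : nat -> fps) : fps :=
  fps_lim (fun K => \sum_(0 <= k < K) f k).

Definition qpoch (A : fps) (n : nat) : fps :=
  \prod_(1 <= j < n.+1) (1 - A * fpsq ^+ j.-1).

Definition qpoch_inf (A : fps) : fps := fps_lim (qpoch A).

Lemma qcoef_lim (u : nat -> fps) n K :
  (forall k, (K <= k)%N -> qcoef n (u k) = qcoef n (u K)) ->
  qcoef n (fps_lim u) = qcoef n (u K).
Proof.
move=> h; rewrite [LHS]/qcoef /=; apply: xget_unique; first by exists K.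
move=> c [L hL]; rewrite -(hL (maxn K L)) ?leq_maxr //.
by rewrite h ?leq_maxl.
Qed.

Lemma qcoef_fps_sum (f : nat -> fps) n :
  (forall k, (n < k)%N -> qcoef n (f k) = 0) ->
  qcoef n (fps_sum f) = \sum_(0 <= k < n.+1) qcoef n (f k).
Proof.
move=> h; rewrite /fps_sum (@qcoef_lim _ _ n.+1) ?qcoef_sum // => k hk.
rewrite !qcoef_sum (@big_cat_nat _ _ _ n.+1) //= [X in _ + X]big_nat_cond.
by rewrite [X in _ + X]big1 ?addr0 // => i; rewrite andbT => /andP[/h].
Qed.

Lemma qcoef_qpoch_inf (A : fps) n : qcoef 0 A = 0 ->
  qcoef n (qpoch_inf A) = qcoef n (qpoch A n).
Proof.
move=> A0; apply: qcoef_lim => k hk.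
rewrite -(subnKC hk); elim: (k - n)%N => [|d IH]; first by rewrite addn0.
rewrite addnS /qpoch big_nat_recr //= -/(qpoch A _) mulrBr mulr1 qcoefD IH.
rewrite qcoefN mulrA qcoefM big1 ?oppr0 ?addr0 // => i _.
have [hlt|hge] := ltnP (n - i)%N (n + d)%N.
  by rewrite [X in _ * X]qcoef_expr_lt ?mulr0.
have -> : nat_of_ord i = 0%N.
  apply/eqP; rewrite -leqn0 leqNgt; apply/negP => i0.
  have n0 : (0 < n)%N by rewrite (leq_trans i0) // -ltnS.
  have : (n - i < n + d)%N by rewrite (@leq_trans n) ?leq_addr // ltn_subrL i0.
  by rewrite ltnNge hge.
by rewrite qcoefM big_ord1 A0 mulr0 mul0r.
Qed.

End PowerSeries.

Arguments fpsq {R}.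

Definition zpow (a : int) : fps (laurent int) := fpsC (lmon a).

Definition rank_series : fps (laurent int) :=
  qpoch_inf fpsq *
  fps_sum (fun k =>
    qpoch (zpow 2) k * qpoch (zpow (-2)) k * fpsq ^+ k /
    (qpoch (- zpow 1 * fpsq) k * qpoch (- zpow (-1) * fpsq) k)).

(* The division is exact: [3 l^2 + l] is even. *)
Definition omega (l : int) : int := ((3 * l ^+ 2 + l) %/ 2)%Z.

Fixpoint chebU (n : nat) : {poly rat} :=
  match n with
  | 0 => 1
  | n'.+1 => match n' with
             | 0 => 2 *: 'X
             | n''.+1 => 2 *: 'X * chebU n' - chebU n''
             end
  end.

(* [U_j(1/2)] for [j >= 0]; only nonnegative indices are meaningful. *)
Definition Uhalf (j : int) : rat := (chebU `|j|).[1 / 2].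

(* A part [(k, o)] is a part of size [k], overlined iff [o]. *)
Definition part := (nat * bool)%type.

(* Parts in weakly decreasing order of size; a part equal in size to the
   preceding one is not a first occurrence, so it is not overlined. *)
Definition overpartition (s : seq part) : bool :=
  all (fun x : part => 0 < x.1)%N s &&
  sorted (fun x y : part => (y.1 < x.1) || ((y.1 == x.1) && ~~ y.2))%N s.

Definition weight (s : seq part) : nat := \sum_(x <- s) x.1.

Definition overlined (s : seq part) : nat := count (fun x : part => x.2) s.

Definition nonoverlined (s : seq part) : nat := count (fun x : part => ~~ x.2) s.

(* The parts of a pair, coded as [(size, (in lambda, overlined))] so that the
   order on parts is the lexicographic one (with [false < true]). *)
Definition pair_part := (nat *l (bool *l bool))%type.

Definition pair_parts (la mu : seq part) : seq pair_part :=
  [seq (x.1, (true, x.2)) | x <- la] ++ [seq (x.1, (false, x.2)) | x <- mu].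

Definition largest (la mu : seq part) : nat := \max_(x <- la ++ mu) x.1.

Definition chi (la mu : seq part) : bool :=
  has (fun x : pair_part => (x.2 == (false, false)) &&
                            all (fun y => (y <= x)%O) (pair_parts la mu))
      (pair_parts la mu).

Definition pair_rank (la mu : seq part) : int :=
  (largest la mu)%:Z - (size la)%:Z - (overlined mu)%:Z - (chi la mu)%:Z.

Definition rank_pairs (r s : nat) (m : int) (n : nat) :
    set (seq part * seq part) :=
  [set p | [/\ overpartition p.1, overpartition p.2,
               (weight p.1 + weight p.2 = n)%N & pair_rank p.1 p.2 = m] /\
           (overlined p.1 + nonoverlined p.2 = r)%N /\ size p.2 = s]%classic.

Lemma overpartition_finite (n : nat) :
  finite_set [set s | overpartition s /\ (weight s <= n)%N]%classic.
Proof.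
pose F (t : n.-bseq ('I_n.+1 * bool)) : seq part :=
  [seq (val x.1, x.2) | x <- t].
apply: (@sub_finite_set _ _ (F @` setT)%classic); last first.
  by apply: finite_image; exact: finite_finset.
move=> s [/andP[pos _] hw].
have hin : all (fun x : part => x.1 < n.+1)%N s.
  apply/allP => x xs; rewrite ltnS (leq_trans _ hw) // /weight.
  by rewrite (big_rem x) //= leq_addr.
have hsz : (size s <= n)%N.
  apply: leq_trans hw; rewrite /weight -sum1_size !big_seq.
  by apply: leq_sum => x xs; exact: (allP pos).
pose t : seq ('I_n.+1 * bool) := [seq (inord x.1, x.2) | x <- s].
have ht : (size t <= n)%N by rewrite size_map.
exists (Bseq ht) => //; rewrite /F /= /t -map_comp -[RHS]map_id.
apply/eq_in_map => -[k o] xs /=; rewrite inordK //.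
exact: (allP hin _ xs).
Qed.

Lemma rank_pairs_finite r s m n : finite_set (rank_pairs r s m n).
Proof.
pose B := [set s | overpartition s /\ (weight s <= n)%N]%classic.
apply: (@sub_finite_set _ _ (B `*` B)%classic).
  by move=> [la mu] [[/= h1 h2 h3 _] _]; split; split; rewrite //= -h3 ?leq_addr ?leq_addl.
by apply: finite_setX; exact: overpartition_finite.
Qed.

Definition Nrank (r s : nat) (m : int) (n : nat) : nat :=
  #|` fset_set (rank_pairs r s m n)|%fset.

(* Main.v *)
Require Import Defs.
From mathcomp Require Import all_boot all_order all_algebra finmap.
From mathcomp Require Import mathcomp_extra boolp classical_sets functions.
From mathcomp Require Import cardinality fsbigop.
From mathcomp Require Import zify ring.

Set Implicit Arguments.
Unset Strict Implicit.
Unset Printing Implicit Defensive.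

Import Order.TTheory GRing.Theory Num.Theory.

Local Open Scope classical_set_scope.
Local Open Scope ring_scope.

(** Write [w = z + 1/z], [T_k] for the [k]-th summand of the series, and [S] for
the sum of the [T_k].  The sum is telescoping: the partial sums satisfy
[(w - 1) (T_0 + ... + T_N) =
 1 - (1 - z) (1 - 1/z) (z^2 q)_N (z^-2 q)_N / ((-z q)_N (-q/z)_N)].
In the limit, after multiplication by [(q)_oo], the right-hand side is evaluated
by the quintuple product identity, which is obtained from a finite form with a
WZ certificate and whose case [z = -1] is Euler's pentagonal number theorem:
[(w - 1) (q)_oo S = \sum_l q^(omega l)
  ((-1)^l + z^(3l+1) + z^(-3l-1) - z^(3l) - z^(-3l))].
The solution of [c (m-1) - c m + c (m+1) = [m = 0]] that vanishes for [m <= 0] is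
[c m = U_(m-1)(1/2)], whence the closed forms.

For the rank generating function, put [d = - z^-2], [e = - z^2] and rank
variable [- z].  Sorting the overpartition pairs by their largest part turns the
signed count into a series [2phi1(-z^-3, -z; -q/z; q, -zq)], up to an affine
transformation.  The q-Gauss sum, proved by a contiguous relation that
telescopes, evaluates it to the same product as above, so both series agree
after multiplication by [w - 1], which is not a zero divisor. *)

(** * Truncated power series *)

Local Arguments qcoef : simpl never.

Lemma invr_sub_unit (F : comUnitRingType) (f g : F) :
  f \is a GRing.unit -> g \is a GRing.unit ->
  f^-1 = g^-1 - f^-1 * g^-1 * (f - g).
Proof.
move=> /mulrV fa /mulrV gb; move: f^-1 g^-1 fa gb => a b fa gb.
by ring: fa gb.
Qed.

Section TruncatedSeries.
Variable R : comNzRingType.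
Implicit Types (f g h : fps R) (c : R).

Lemma qcoef0E n : qcoef n (0 : fps R) = 0.
Proof. by rewrite /qcoef /=; case: eqP. Qed.

Lemma qcoef_fpsC n c : qcoef n (fpsC c) = if n == 0%N then c else 0.
Proof. by []. Qed.

Lemma qcoefCM n c f : qcoef n (fpsC c * f) = c * qcoef n f.
Proof.
rewrite qcoefM big_ord_recl /= subn0 big1 ?addr0 // => i _.
by rewrite qcoef_fpsC mul0r.
Qed.

Lemma fpsC1 : fpsC (1 : R) = 1.
Proof. by []. Qed.

Lemma fpsCN c : fpsC (- c) = - fpsC c.
Proof. by apply: fpsP => n; rewrite qcoefN !qcoef_fpsC; case: eqP; rewrite ?oppr0. Qed.

Lemma fpsCD c d : fpsC (c + d) = fpsC c + fpsC d.
Proof. by apply: fpsP => n; rewrite qcoefD !qcoef_fpsC; case: eqP; rewrite ?addr0. Qed.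

Lemma fpsCM c d : fpsC (c * d) = fpsC c * fpsC d.
Proof. by apply: fpsP => n; rewrite qcoefCM !qcoef_fpsC; case: eqP; rewrite ?mulr0. Qed.

Lemma fpsCX c n : fpsC (c ^+ n) = fpsC c ^+ n.
Proof. by elim: n => [|n IH]; rewrite ?expr0 // !exprS fpsCM IH. Qed.

Lemma qcoef_qM n f : qcoef n (fpsq * f) = if n is m.+1 then qcoef m f else 0.
Proof.
case: n => [|n]; first by rewrite qcoefM big_ord1 mul0r.
rewrite qcoefM big_ord_recl [qcoef ord0 _]/qcoef mul0r add0r big_ord_recl.
rewrite [qcoef (lift _ _) _]/qcoef /= mul1r big1 => [|i _].
  by rewrite addr0 subSS subn0.
by rewrite mul0r.
Qed.

Lemma qcoef_qXM k n f :
  qcoef n (fpsq ^+ k * f) = if (n < k)%N then 0 else qcoef (n - k) f.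
Proof.
elim: k n => [|k IH] n; first by rewrite expr0 mul1r subn0.
rewrite exprS -mulrA qcoef_qM; case: n => [|n] //; exact: IH.
Qed.

Lemma fpsqX_inj k : injective (GRing.mul (fpsq ^+ k : fps R)).
Proof.
move=> f g h; apply: fpsP => n; have := congr1 (qcoef (n + k)) h.
by rewrite !qcoef_qXM ltnNge leq_addl addnK.
Qed.

(** Congruence modulo [q^n]. The explicit witness lets [ring] prove compatibility with the
    operations; [eqmodqP] gives back the coefficientwise form. *)
Definition eqmodq n f g := exists h, f = g + fpsq ^+ n * h.

Lemma eqmodqP n f g :
  eqmodq n f g <-> forall i, (i < n)%N -> qcoef i f = qcoef i g.
Proof.
split=> [[h ->] i lin|fg]; first by rewrite qcoefD qcoef_qXM lin addr0.
exists (Fps (fun i => qcoef (n + i) (f - g))); apply: fpsP => i.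
rewrite qcoefD qcoef_qXM; case: ltnP => [/fg->|le_ni]; first by rewrite addr0.
rewrite [X in _ = _ + X]/qcoef /= subnKC //.
by rewrite qcoefD qcoefN addrC subrK.
Qed.

Lemma eqmodq_refl n f : eqmodq n f f.
Proof. by exists 0; rewrite mulr0 addr0. Qed.

Lemma eqmodq_sym n f g : eqmodq n f g -> eqmodq n g f.
Proof. by case=> h ->; exists (- h); ring. Qed.

Lemma eqmodq_trans n g f h : eqmodq n f g -> eqmodq n g h -> eqmodq n f h.
Proof. by case=> a -> [b ->]; exists (a + b); ring. Qed.

Lemma eqmodqD n f g f' g' :
  eqmodq n f g -> eqmodq n f' g' -> eqmodq n (f + f') (g + g').
Proof. by case=> a -> [b ->]; exists (a + b); ring. Qed.

Lemma eqmodqN n f g : eqmodq n f g -> eqmodq n (- f) (- g).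
Proof. by case=> a ->; exists (- a); ring. Qed.

Lemma eqmodqB n f g f' g' :
  eqmodq n f g -> eqmodq n f' g' -> eqmodq n (f - f') (g - g').
Proof. by move=> h1 /eqmodqN; exact: eqmodqD. Qed.

Lemma eqmodqM n f g f' g' :
  eqmodq n f g -> eqmodq n f' g' -> eqmodq n (f * f') (g * g').
Proof.
by case=> a -> [b ->]; exists (a * g' + g * b + a * fpsq ^+ n * b); ring.
Qed.

Lemma eqmodqMl n h f g : eqmodq n f g -> eqmodq n (h * f) (h * g).
Proof. exact: eqmodqM (eqmodq_refl _ _). Qed.

Lemma eqmodqMr n h f g : eqmodq n f g -> eqmodq n (f * h) (g * h).
Proof. by move=> fg; apply: eqmodqM fg (eqmodq_refl _ _). Qed.

Lemma eqmodq_leq m n f g : (m <= n)%N -> eqmodq n f g -> eqmodq m f g.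
Proof.
by move=> mn [h ->]; exists (fpsq ^+ (n - m) * h); rewrite mulrA -exprD subnKC.
Qed.

Lemma eqmodq_qX n k f : (n <= k)%N -> eqmodq n (fpsq ^+ k * f) 0.
Proof.
by move=> nk; exists (fpsq ^+ (k - n) * f); rewrite add0r mulrA -exprD subnKC.
Qed.

Lemma eqmodq_sum n (I : Type) (r : seq I) (P : pred I) (F G : I -> fps R) :
  (forall i, P i -> eqmodq n (F i) (G i)) ->
  eqmodq n (\sum_(i <- r | P i) F i) (\sum_(i <- r | P i) G i).
Proof.
by move=> h; elim/big_rec2: _ => [|i f g /h]; [exact: eqmodq_refl|exact: eqmodqD].
Qed.

Lemma eqmodq_sum0 n (I : Type) (r : seq I) (P : pred I) (F : I -> fps R) :
  (forall i, P i -> eqmodq n (F i) 0) -> eqmodq n (\sum_(i <- r | P i) F i) 0.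
Proof. by move=> /(eqmodq_sum r); rewrite big1_eq. Qed.

Lemma eqmodqV n f g : f \is a GRing.unit -> g \is a GRing.unit ->
  eqmodq n f g -> eqmodq n f^-1 g^-1.
Proof.
move=> uf ug [h fg]; exists (- (h * (f^-1 * g^-1))).
rewrite {1}(invr_sub_unit uf ug); have -> : f - g = fpsq ^+ n * h by rewrite fg; ring.
by ring.
Qed.

Lemma qcoef0M f g : qcoef 0 (f * g) = qcoef 0 f * qcoef 0 g.
Proof. by rewrite qcoefM big_ord1. Qed.

Lemma qcoef0_q : qcoef 0 (fpsq : fps R) = 0. Proof. by []. Qed.

Lemma qcoef0_Mq f : qcoef 0 (f * fpsq) = 0.
Proof. by rewrite qcoef0M qcoef0_q mulr0. Qed.

Lemma qpoch0 f : qpoch f 0 = 1.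
Proof. by rewrite /qpoch big_geq. Qed.

Lemma qpochS f n : qpoch f n.+1 = qpoch f n * (1 - f * fpsq ^+ n).
Proof. by rewrite /qpoch big_nat_recr. Qed.

Lemma qpochSl f n : qpoch f n.+1 = (1 - f) * qpoch (f * fpsq) n.
Proof.
elim: n => [|n IH]; first by rewrite qpochS !qpoch0 expr0; ring.
by rewrite qpochS IH [in RHS]qpochS exprS; ring.
Qed.

Lemma fps_unit_sub1 f : qcoef 0 f = 0 -> 1 - f \is a GRing.unit.
Proof. by move=> f0; apply: fps_unit; rewrite qcoefD qcoefN f0 subr0. Qed.

Lemma qpoch_unit f n : qcoef 0 f = 0 -> qpoch f n \is a GRing.unit.
Proof.
move=> f0; elim: n => [|n IH]; first by rewrite qpoch0 unitr1.
by rewrite qpochS unitrM IH fps_unit_sub1 // qcoef0M f0 mul0r.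
Qed.

Lemma qcoef0_divq f : qcoef 0 f = 0 -> exists g, f = fpsq * g.
Proof.
move=> f0; have [|g fg] := (eqmodqP 1 f 0).2.
  by case=> // _; rewrite f0 qcoef0E.
by exists g; rewrite {1}fg add0r expr1.
Qed.

(** Since [f] is divisible by [q], every factor after the first [n] is [1] modulo [q^(n+1)]. *)
Lemma eqmodq_qpoch f m n : qcoef 0 f = 0 -> (n <= m)%N ->
  eqmodq n.+1 (qpoch f m) (qpoch f n).
Proof.
move=> /qcoef0_divq[g ->] /subnKC <-; elim: (m - n)%N => [|d IH].
  by rewrite addn0; exact: eqmodq_refl.
rewrite addnS qpochS -[X in eqmodq _ _ X]mulr1; apply: eqmodqM => //.
exists (- (g * fpsq ^+ d)).
by rewrite exprD exprS; ring.
Qed.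

Lemma eqmodq_qpoch_inf f n : qcoef 0 f = 0 ->
  eqmodq n.+1 (qpoch_inf f) (qpoch f n).
Proof.
move=> f0; apply/eqmodqP => i; rewrite ltnS => lin.
rewrite qcoef_qpoch_inf //.
by apply/esym/(eqmodqP i.+1 _ _).1 => //; exact: eqmodq_qpoch.
Qed.

Lemma eqmodq_fps (f g : fps R) : (forall n, eqmodq n f g) -> f = g.
Proof. by move=> h; apply: fpsP => n; exact: (eqmodqP n.+1 f g).1. Qed.

Lemma eqmodq_fps_sum (F : nat -> fps R) n :
  (forall k, eqmodq k (F k) 0) -> eqmodq n (fps_sum F) (\sum_(0 <= k < n) F k).
Proof.
move=> F0; have z i k : (i < k)%N -> qcoef i (F k) = 0.
  by move=> ik; rewrite ((eqmodqP k (F k) 0).1 (F0 k) i ik) qcoef0E.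
apply/eqmodqP => i lin; rewrite qcoef_fps_sum => [|k /z //].
rewrite qcoef_sum [RHS](@big_cat_nat _ _ _ i.+1) //= [X in _ = _ + X]big_nat_cond.
by rewrite [X in _ = _ + X]big1 ?addr0 // => k /andP[/andP[/z]].
Qed.

End TruncatedSeries.

(** * Telescoping sums *)

Section RingIdentities.
Variable F : comNzRingType.
Implicit Types (u v x Q X Y Z i s : F).

(** Induction step of [rank_term_telescope]: [Q] is [q^(N+1)], [P] and [P'] are the numerators of
    [rank_prod] at [N], and [i] is the inverse of its denominator at [N+1]. *)
Lemma rank_telescope_step u v Q i (P P' : F) : u * v = 1 ->
  1 - (1 - u) * (1 - v) * (P * P' * ((1 + u * Q) * (1 + v * Q) * i)) +
  (u - 1 + v) * ((1 - u ^+ 2) * P * ((1 - v ^+ 2) * P') * Q * i) =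
  1 - (1 - u) * (1 - v) *
    (P * (1 - u ^+ 2 * Q) * (P' * (1 - v ^+ 2 * Q)) * i).
Proof. by move=> uv; ring: uv. Qed.

(** Here [Q = q^K], [s] and [s'] are the [K]-th terms [t_K] at [x] and at [x q], and [s1] is
    [(1 - q^(K+1)) t_(K+1)] at [x]. The right-hand side is then a difference of consecutive values
    of [-(1 - x)(1 - q^K) t_K]. *)
Lemma gauss_telescope_step (A A' B B' x Q i s s' s1 : F) :
  A * A' = 1 -> B * B' = 1 -> (1 - x * Q) * i = 1 ->
  s' = s * Q * (1 - x) * i ->
  s1 = s * (1 - A * Q) * (1 - B * Q) * (x * A' * B') * i ->
  (1 - x) * (1 - x * A' * B') * s - (1 - x * A') * (1 - x * B') * s' =
  - ((1 - x) * s1) + (1 - x) * (1 - Q) * s.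
Proof.
move=> AA BB xi -> ->.
have -> : s = s * ((1 - x * Q) * i) by rewrite xi mulr1.
have e1 : i * (1 - x * Q) = 1 by rewrite mulrC.
have e : i * x * Q = i - 1 by rewrite -e1; ring.
by ring: AA BB e.
Qed.

(** The polynomial core of [quint_cert_step], with [X = q^k], [Y = q^(2N-k)], [Z = q^N]. The two
    summands on the right come from the certificate at [k+1] and at [k]. *)
Lemma quintuple_telescope_step q u v X Y Z : u * v = 1 -> Z * Z = X * Y ->
  (Z - u * X) * ((1 - q * X * Y) * (1 - q ^+ 2 * X * Y) *
                 (1 + u * q * Z) * (1 + v * q * Z) -
     (1 - q * X) * (1 - u ^+ 2 * q * X) * (1 - q * Y) * (1 - v ^+ 2 * q * Y)) =
  - u ^+ 3 * q * X ^+ 2 * (1 - q * Y) * (1 - v ^+ 2 * q * Y) *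
     ((1 - q * X) * (1 - v ^+ 2 * Y) +
      v ^+ 2 * (1 - q * X * Y) * (1 + u * q * Z)) +
  Z * q * Y * (1 - q * X) * (1 - u ^+ 2 * q * X) *
     ((1 - X) * (1 - v ^+ 2 * q * Y) +
      v ^+ 2 * (1 - q * X * Y) * (1 + u * q * Z)).
Proof. by move=> uv ZZ; ring: uv ZZ. Qed.

End RingIdentities.

Lemma div_cancel_unit (F : comUnitRingType) (s n a c : F) :
  a \is a GRing.unit -> c \is a GRing.unit -> a * (s * (n / (a * c))) = s * n / c.
Proof.
move=> ua uc; rewrite invrM //.
have := mulVr ua; move: a^-1 c^-1 => a' c' aa.
by ring: aa.
Qed.

Lemma div_shift_unit (F : comUnitRingType) (n q a b c : F) :
  a \is a GRing.unit -> b \is a GRing.unit -> c \is a GRing.unit ->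
  n * q / (a * c) * c = n / (a * b) * (q * b).
Proof.
move=> ua ub uc; rewrite !invrM //.
have := mulVr ub; have := mulVr uc; move: a^-1 b^-1 c^-1 => a' b' c' cc bb.
by ring: cc bb.
Qed.

Section Telescoping.
Variables (R : comNzRingType) (u v : fps R).
Hypothesis uv1 : u * v = 1.
Local Notation q := (fpsq : fps R).

Definition rank_term k : fps R :=
  qpoch (u ^+ 2) k * qpoch (v ^+ 2) k * q ^+ k /
  (qpoch (- u * q) k * qpoch (- v * q) k).

(** The meeting point of the evaluations: it closes the telescoping sum, it is the value of the
    q-Gauss sum, and times [(1 - u) (q)_N] it is a truncated quintuple product. *)
Definition rank_prod N : fps R :=
  qpoch (u ^+ 2 * q) N * qpoch (v ^+ 2 * q) N /
  (qpoch (- u * q) N * qpoch (- v * q) N).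

Lemma rank_term_telescope N :
  (u - 1 + v) * (\sum_(0 <= k < N.+1) rank_term k) =
  1 - (1 - u) * (1 - v) * rank_prod N.
Proof.
elim: N => [|N IH].
  rewrite big_nat1 /rank_term /rank_prod !qpoch0 expr0 !mulr1 divr1.
  by ring: uv1.
rewrite big_nat_recr //= mulrDr IH.
(* Only the numerators of the new term are split on the left, so that [(u^2 q)_N] and [(v^2 q)_N]
   appear on both sides. *)
rewrite /rank_term /rank_prod [qpoch (u ^+ 2) _]qpochSl [qpoch (v ^+ 2) _]qpochSl.
rewrite ![qpoch _ N.+1]qpochS.
have UD f : 1 - f * q * q ^+ N \is a GRing.unit.
  by apply: fps_unit_sub1; rewrite qcoef0M qcoef0_Mq mul0r.
have UQ f : qpoch (f * q) N \is a GRing.unit by rewrite qpoch_unit ?qcoef0_Mq.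
set D := qpoch (- u * q) N * qpoch (- v * q) N.
set E := qpoch (- u * q) N * _ * _.
have -> : E = D * ((1 + u * q ^+ N.+1) * (1 + v * q ^+ N.+1)).
  by rewrite /E /D exprS; ring.
set C := (1 + u * q ^+ N.+1) * _.
have UC : C \is a GRing.unit.
  have := UD (- u); have := UD (- v); rewrite !mulNr !opprK -!mulrA -!exprS.
  by rewrite unitrM => -> ->.
have UDD : D \is a GRing.unit by rewrite unitrM !UQ.
have -> : D^-1 = C * (D * C)^-1 by rewrite (invrM UDD UC) mulVKr.
rewrite rank_telescope_step // (exprS q N); congr (_ - _ * (_ * _)).
by rewrite !mulrA.
Qed.

(** * The q-Gauss sum *)

Let x M : fps R := - v * q ^+ M.+1.

(* With [u = z], [gauss_term M] lists the terms of the q-Gauss sum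
   [2phi1(-z^-3, -z; x; q, z^2 x)] at [x = x M]; [gauss_telescope] relates
   the parameters [x] and [x q]. *)
Definition gauss_factor M i : fps R :=
  (1 + v ^+ 3 * q ^+ i) * (1 + u * q ^+ i) * (- u * q ^+ M.+1) /
  ((1 - q ^+ i.+1) * (1 - x M * q ^+ i)).

Definition gauss_term M N : fps R := \prod_(0 <= i < N) gauss_factor M i.

Let unit_q n (f : fps R) : 1 - f * q ^+ n.+1 \is a GRing.unit.
Proof. by apply: fps_unit_sub1; rewrite exprSr mulrA qcoef0_Mq. Qed.

Let unit_q1 n : 1 - q ^+ n.+1 \is a GRing.unit.
Proof. by rewrite -[q ^+ _]mul1r; exact: unit_q. Qed.

Let unit_x M i : 1 - x M * q ^+ i \is a GRing.unit.
Proof. by rewrite /x -mulrA -exprD addSn; exact: unit_q. Qed.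

Lemma gauss_termS M N : gauss_term M N.+1 = gauss_term M N * gauss_factor M N.
Proof. by rewrite /gauss_term big_nat_recr. Qed.

Lemma gauss_factor_shift M N :
  gauss_factor M.+1 N * (1 - x M * q ^+ N.+1) =
  gauss_factor M N * (q * (1 - x M * q ^+ N)).
Proof.
have e : x M.+1 * q ^+ N = x M * q ^+ N.+1 by rewrite /x !exprS; ring.
rewrite /gauss_factor e [q ^+ M.+2]exprS [- u * (_ * _)]mulrCA [q * (- u * _)]mulrC.
by rewrite [_ * (_ * q)]mulrA; exact: div_shift_unit.
Qed.

(** By [gauss_factor_shift] each factor gains [q (1 - x q^i) / (1 - x q^(i+1))], and the product of
    these quotients collapses. *)
Lemma gauss_term_shift M N :
  gauss_term M.+1 N * (1 - x M * q ^+ N) = gauss_term M N * (q ^+ N * (1 - x M)).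
Proof.
elim: N => [|N IH].
  by rewrite /gauss_term !big_geq // expr0 !mul1r mulr1.
rewrite !gauss_termS -mulrA gauss_factor_shift exprS.
transitivity (gauss_term M.+1 N * (1 - x M * q ^+ N) * gauss_factor M N * q).
  by ring.
by rewrite IH; ring.
Qed.

(** The contiguous relation for partial sums; the right-hand side is the boundary term, negligible
    by [gauss_term_small]. *)
Lemma gauss_telescope M K :
  (1 - x M) * (1 + u * q ^+ M.+1) * (\sum_(0 <= N < K) gauss_term M N) -
  (1 - u ^+ 2 * q ^+ M.+1) * (1 - v ^+ 2 * q ^+ M.+1) *
    (\sum_(0 <= N < K) gauss_term M.+1 N) =
  - ((1 - x M) * (1 - q ^+ K) * gauss_term M K).
Proof.
elim: K => [|K IH]; first by rewrite !big_geq // expr0 subrr !mulr0 mul0r subrr oppr0.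
have lin (a b c d s s' : fps R) :
  a * (c + s) - b * (d + s') = (a * c - b * d) + (a * s - b * s') by ring.
rewrite !big_nat_recr //= lin IH.
set S := gauss_term M K; set S' := gauss_term M.+1 K.
(* The upper parameters of the series are [-v^3] and [-u]; their inverses are [-u^3] and [-v]. *)
have uv3 : (- v ^+ 3) * (- u ^+ 3) = 1 by ring: uv1.
have vu : (- u) * (- v) = 1 by ring: uv1.
have xi : (1 - x M * q ^+ K) * (1 - x M * q ^+ K)^-1 = 1 by exact: mulrV.
have e' : S' = S * q ^+ K * (1 - x M) * (1 - x M * q ^+ K)^-1.
  by apply: (mulIr (unit_x M K)); rewrite mulrVK // gauss_term_shift mulrA.
have e1 : (1 - q ^+ K.+1) * gauss_term M K.+1 =
   S * (1 - (- v ^+ 3) * q ^+ K) * (1 - (- u) * q ^+ K) *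
   (x M * (- u ^+ 3) * (- v)) * (1 - x M * q ^+ K)^-1.
  rewrite gauss_termS /gauss_factor -/S div_cancel_unit //.
  have -> : x M * - u ^+ 3 * - v = - u * q ^+ M.+1.
    by rewrite /x; ring: uv1.
  by rewrite !mulNr !opprK !mulrA.
have := gauss_telescope_step uv3 vu xi e' e1.
have -> : x M * - u ^+ 3 * - v = - u * q ^+ M.+1 by rewrite /x; ring: uv1.
have -> : x M * - u ^+ 3 = u ^+ 2 * q ^+ M.+1 by rewrite /x; ring: uv1.
have -> : x M * - v = v ^+ 2 * q ^+ M.+1 by rewrite /x; ring.
rewrite mulNr opprK => ->.
by rewrite -[(1 - x M) * (1 - q ^+ K.+1) * _]mulrA; ring.
Qed.

Lemma gauss_term_small M N : eqmodq (M.+1 * N) (gauss_term M N) 0.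
Proof.
elim: N => [|N [h IH]].
  by exists 1; rewrite muln0 /gauss_term big_geq // add0r mulr1.
exists (h * (- ((1 + v ^+ 3 * q ^+ N) * (1 + u * q ^+ N) * u) /
  ((1 - q ^+ N.+1) * (1 - x M * q ^+ N)))).
by rewrite gauss_termS IH mulnS exprD /gauss_factor; ring.
Qed.

(** [M] applications of the contiguous relation, each discarding a boundary term divisible by
    [q^((M+1)K)], hence by [q^K]. *)
Lemma gauss_sum_shift M K :
  eqmodq K (qpoch (- u * q) M * qpoch (- v * q) M *
              (\sum_(0 <= N < K) gauss_term 0 N))
           (qpoch (u ^+ 2 * q) M * qpoch (v ^+ 2 * q) M *
              (\sum_(0 <= N < K) gauss_term M N)).
Proof.
elim: M => [|M IH]; first by rewrite !qpoch0; exact: eqmodq_refl.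
have [h hE] := gauss_term_small M K.
have KM : (K <= M.+1 * K)%N by rewrite leq_pmull.
have := gauss_telescope M K; rewrite hE add0r => /eqP; rewrite subr_eq => /eqP E.
rewrite !qpochS.
apply: (@eqmodq_trans _ _ ((1 - x M) * (1 + u * q ^+ M.+1) *
  (qpoch (u ^+ 2 * q) M * qpoch (v ^+ 2 * q) M *
              (\sum_(0 <= N < K) gauss_term M N)))).
  have -> : (1 - x M) * (1 + u * q ^+ M.+1) =
     (1 - - u * q * q ^+ M) * (1 - - v * q * q ^+ M) by rewrite /x exprS; ring.
  case: IH => g; set a := \sum_(_ <= _ < _) _; set b := \sum_(_ <= _ < _) _ => IH.
  exists ((1 - - u * q * q ^+ M) * (1 - - v * q * q ^+ M) * g).
  set c := q ^+ K in IH *.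
  rewrite [RHS](_ : _ = (1 - - u * q * q ^+ M) * (1 - - v * q * q ^+ M) *
    (qpoch (u ^+ 2 * q) M * qpoch (v ^+ 2 * q) M * b + c * g)); last by ring.
  by rewrite -IH; ring.
rewrite mulrCA E -(subnKC KM) exprD.
set b := \sum_(_ <= _ < _) _.
exists (- (qpoch (u ^+ 2 * q) M * qpoch (v ^+ 2 * q) M *
   ((1 - x M) * (1 - q ^+ K) * (q ^+ (M.+1 * K - K) * h)))).
by rewrite [q ^+ M.+1]exprS; ring.
Qed.

(** After [K] shifts the parameter [x] is so small that only the initial term [1] of the shifted sum
    survives modulo [q^K]. *)
Lemma gauss_sum K :
  eqmodq K (\sum_(0 <= N < K) gauss_term 0 N) (rank_prod K).
Proof.
case: K => [|K]; first by apply/eqmodqP.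
have [g E] := gauss_sum_shift K.+1 K.+1.
rewrite /rank_prod; set D := qpoch (- u * q) K.+1 * _ in E *.
have UD : D \is a GRing.unit by rewrite unitrM !qpoch_unit ?qcoef0_Mq.
apply: (@eqmodq_trans _ _ (qpoch (u ^+ 2 * q) K.+1 * qpoch (v ^+ 2 * q) K.+1 *
  (\sum_(0 <= N < K.+1) gauss_term K.+1 N) / D)).
  exists (g / D).
  by rewrite -[LHS](mulKr UD) E mulrC mulrDl [in RHS]mulrA.
apply: eqmodqMr; rewrite -[X in eqmodq _ _ X]mulr1; apply: eqmodqMl.
rewrite big_nat_recl // {1}/gauss_term big_geq // -[X in eqmodq _ _ X]addr0.
apply: eqmodqD; first exact: eqmodq_refl.

apply: eqmodq_sum0 => i _; apply: eqmodq_leq (gauss_term_small _ _).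
by rewrite (leq_trans (leqnSn _)) // leq_pmulr.
Qed.

End Telescoping.

(** * The quintuple product *)

(** The form of [omega] used in all later arithmetic, free of the division. *)
Lemma omega_mul2 (l : int) : omega l * 2 = 3 * l ^+ 2 + l.
Proof.
rewrite /omega divzK //; apply/dvdz_mod0P.
have [k [->|->]] : exists k : int, l = 2 * k \/ l = 2 * k + 1.
  exists (l %/ 2)%Z; have := divz_eq l 2; have := modz_ge0 l (d := 2) isT.
  by have := ltz_pmod l (d := 2) isT; lia.
  have -> : 3 * (2 * k) ^+ 2 + 2 * k = (6 * k ^+ 2 + k) * 2 by ring.
  by rewrite modzMl.
have -> : 3 * (2 * k + 1) ^+ 2 + (2 * k + 1) = (6 * k ^+ 2 + 7 * k + 2) * 2.
  by ring.
by rewrite modzMl.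
Qed.

Lemma omega_ge_norm (l : int) : `|l| <= omega l.
Proof. by have := omega_mul2 l; rewrite expr2; nia. Qed.

Lemma omega_ge0 (l : int) : 0 <= omega l.
Proof. exact: le_trans (omega_ge_norm l). Qed.

(** The difference of two values factors, and the factor [3 (a + b) + 1] is not divisible by [3],
    hence nonzero. *)
Lemma omega_inj : injective omega.
Proof.
move=> a b ab; have := omega_mul2 a; have := omega_mul2 b.
rewrite ab => -> E.
have /eqP : (b - a) * (3 * (b + a) + 1) = 0.
  transitivity ((3 * b ^+ 2 + b) - (3 * a ^+ 2 + a)); first by ring.
  by rewrite E subrr.
by rewrite mulf_eq0 => /orP[]/eqP; lia.
Qed.

Lemma div_split_unit (F : comUnitRingType) (U V a A B : F) :
  a \is a GRing.unit -> A \is a GRing.unit -> B \is a GRing.unit ->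
  U * V / (a * A * B) = a * U * V * (a * A)^-1 * (a * B)^-1.
Proof.
move=> ua uA uB; rewrite !invrM ?unitrM ?ua //.
have := mulVr ua; move: a^-1 A^-1 B^-1 => a' A' B' aa.
by ring: aa.
Qed.

Lemma div_inv_unit (F : comUnitRingType) (x y z : F) :
  y \is a GRing.unit -> z \is a GRing.unit -> x / (y / z) = x * z / y.
Proof. by move=> uy uz; rewrite invrM ?unitrV // invrK mulrA. Qed.

Section Quintuple.
Variables (R : comNzRingType) (up : int -> fps R).
Hypothesis up0 : up 0 = 1.
Hypothesis upD : forall a b, up (a + b) = up a * up b.
Local Notation q := (fpsq : fps R).
Local Notation u := (up 1).
Local Notation v := (up (-1)).
Local Notation pent j := `|omega j|%N.

(** This is [omega j - omega (-j) = j], with [j = a - b] to stay within natural exponents. *)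
Lemma pent_shift (j : int) (a b : nat) :
  j = a%:Z - b%:Z -> (pent j + b = pent (- j) + a)%N.
Proof.
have := omega_mul2 j; have := omega_mul2 (- j).
by have := omega_ge0 j; have := omega_ge0 (- j); rewrite sqrrN; lia.
Qed.

Lemma up_uv : u * v = 1.
Proof. by rewrite -upD up0. Qed.

Definition quint_head (j : int) : fps R := up (3 * j) * q ^+ pent (- j).

(** The [j]-th pair of terms on the series side of the quintuple product. The map [up] stands for
    the powers of [z] and is left abstract so that it can also be specialized to [z = -1]. *)
Definition quint_term (j : int) : fps R :=
  up (3 * j) * q ^+ pent (- j) - up (3 * j + 1) * q ^+ pent j.

(** The factorization [quint_term j = quint_head j (1 - u q^j)], with the possibly negative power of
    [q] cleared. *)
Lemma quint_termM (j : int) (a b : nat) : j = a%:Z - b%:Z ->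
  q ^+ b * quint_term j = quint_head j * (q ^+ b - u * q ^+ a).
Proof.
move=> jE; have e : q ^+ b * q ^+ pent j = q ^+ pent (- j) * q ^+ a.
  by rewrite -!exprD addnC (pent_shift jE).
rewrite /quint_term /quint_head upD mulrBr.
have -> : q ^+ b * (up (3 * j) * u * q ^+ pent j) =
   up (3 * j) * u * (q ^+ b * q ^+ pent j) by ring.
by rewrite e; ring.
Qed.

(** Consecutive heads have ratio [u^3 q^(3j+1)]; the exponents are again rearranged to be natural
    numbers. *)
Lemma quint_headS (j : int) (a b c : nat) : j = a%:Z - b%:Z -> (a + c = b + b)%N ->
  q ^+ b * (quint_head (j + 1) * q ^+ c) =
  quint_head j * (u ^+ 3 * q * q ^+ a ^+ 2).
Proof.
move=> jE ac.
have pE : (b + pent (- (j + 1)) + c = pent (- j) + 1 + a * 2)%N.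
  have := omega_mul2 (- j); have := omega_mul2 (- (j + 1)).
  have := omega_ge0 (- j); have := omega_ge0 (- (j + 1)).
  by rewrite !sqrrN sqrrD1; lia.
have e : q ^+ b * q ^+ pent (- (j + 1)) * q ^+ c =
         q ^+ pent (- j) * q * q ^+ a ^+ 2.
  by rewrite -exprM -exprSr -!exprD pE addn1.
have u3 : up (3 * (j + 1)) = up (3 * j) * u ^+ 3.
  by rewrite !exprS expr0 mulr1 -!upD; congr up; ring.
transitivity (up (3 * (j + 1)) * (q ^+ b * q ^+ pent (- (j + 1)) * q ^+ c)).
  by rewrite /quint_head; ring.
by rewrite e u3 /quint_head; ring.
Qed.

Let ia k : fps R := (qpoch q k * qpoch (u ^+ 2 * q) k)^-1.
Let ib k : fps R := (qpoch q k * qpoch (v ^+ 2 * q) k)^-1.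
Let cN N : fps R :=
  qpoch q N.*2 * qpoch (- u * q) N * qpoch (- v * q) N.

(* The summand and the WZ certificate of [quint_fin_sum], a bilateral form of the
   finite quintuple product identity of Chen, Chu and Gu; the summation index is
   [k - N], shifted to a natural number. *)
Definition quint_fin N k : fps R :=
  quint_term (k%:Z - N%:Z) * (cN N * ia k * ib (N.*2 - k)).

Definition quint_cert N k : fps R :=
  - (quint_head (k%:Z - N%:Z) * q ^+ (N.*2.+1 - k) *
     (cN N * ia k * ib (N.*2.+1 - k)) *
     ((1 - q ^+ k) * (1 - v ^+ 2 * q ^+ (N.*2.+1 - k)) +
      v ^+ 2 * (1 - q ^+ N.*2.+1) * (1 + u * q ^+ N.+1))).

(** Inverses are written through those of larger index, so that the certificate equation becomes
    polynomial. *)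
Let inv_step (f : fps R) k :
  (qpoch q k * qpoch (f * q) k)^-1 =
  (qpoch q k.+1 * qpoch (f * q) k.+1)^-1 *
    ((1 - q ^+ k.+1) * (1 - f * q ^+ k.+1)).
Proof.
have U1 : qpoch q k \is a GRing.unit by apply: qpoch_unit.
have U2 : qpoch (f * q) k \is a GRing.unit by rewrite qpoch_unit ?qcoef0_Mq.
have U3 : 1 - q ^+ k.+1 \is a GRing.unit.
  by apply: fps_unit_sub1; rewrite exprSr qcoef0_Mq.
have U4 : 1 - f * q ^+ k.+1 \is a GRing.unit.
  by apply: fps_unit_sub1; rewrite exprSr mulrA qcoef0_Mq.
rewrite !qpochS -[f * q * _]mulrA -!exprS.
have -> : qpoch q k * (1 - q ^+ k.+1) * (qpoch (f * q) k * (1 - f * q ^+ k.+1))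
  = qpoch q k * qpoch (f * q) k * ((1 - q ^+ k.+1) * (1 - f * q ^+ k.+1)).
  by ring.
have UM : (1 - q ^+ k.+1) * (1 - f * q ^+ k.+1) \is a GRing.unit.
  by rewrite unitrM U3.
have UN : qpoch q k * qpoch (f * q) k \is a GRing.unit by rewrite unitrM U1.
by rewrite [in RHS](invrM UN UM) [RHS]mulrC (mulVKr UM).
Qed.

Let iaS k : ia k = ia k.+1 * ((1 - q ^+ k.+1) * (1 - u ^+ 2 * q ^+ k.+1)).
Proof. exact: inv_step. Qed.

Let ibS k : ib k = ib k.+1 * ((1 - q ^+ k.+1) * (1 - v ^+ 2 * q ^+ k.+1)).
Proof. exact: inv_step. Qed.

Let ia0 : ia 0 = 1. Proof. by rewrite /ia !qpoch0 mulr1 invr1. Qed.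
Let ib0 : ib 0 = 1. Proof. by rewrite /ib !qpoch0 mulr1 invr1. Qed.

Let cNS N : cN N.+1 = cN N * ((1 - q ^+ N.*2.+1) * (1 - q ^+ N.*2.+2) *
  ((1 + u * q ^+ N.+1) * (1 + v * q ^+ N.+1))).
Proof. by rewrite /cN doubleS !qpochS !exprS; ring. Qed.

(* Both sides are multiplied by [q ^+ N] to avoid negative powers of [q]. *)
Lemma quint_cert_step N k : (k <= N.*2)%N ->
  quint_fin N.+1 k.+1 - quint_fin N k = quint_cert N k.+1 - quint_cert N k.
Proof.
move=> kN; set j : int := k%:Z - N%:Z.
have [i iE] : exists i, (k + i = N.*2)%N by exists (N.*2 - k)%N; rewrite subnKC.
have e1 : (N.*2 - k = i)%N by rewrite -iE addKn.
have e2 : (N.*2.+1 - k = i.+1)%N by rewrite -iE -addnS addKn.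
have e3 : (N.+1.*2 - k.+1 = i.+1)%N by rewrite doubleS subSS e2.
have e4 : (N.*2.+1 - k.+1 = i)%N by rewrite subSS e1.
have ZZ : q ^+ N * q ^+ N = q ^+ k * q ^+ i by rewrite -!exprD iE addnn.
have tE := @quint_termM j k N erefl.
have hE := @quint_headS j k N i erefl ltac:(by rewrite iE addnn).
apply: (@fpsqX_inj _ N); rewrite /quint_fin /quint_cert e1 e2 e3 e4.
rewrite [k.+1%:Z - N.+1%:Z](_ : _ = j); last by rewrite /j; lia.
rewrite [k.+1%:Z - N%:Z](_ : _ = j + 1); last by rewrite /j; lia.
rewrite -/j cNS [ia k]iaS [ib i]ibS.
have := quintuple_telescope_step q up_uv ZZ.
have dE : q ^+ N.*2 = q ^+ k * q ^+ i by rewrite -exprD iE.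
move: tE hE; rewrite (exprS q k) (exprS q i) (exprS q N) (exprS q N.*2.+1).
rewrite (exprS q N.*2) dE.
(* With powers and inverses generalized, what remains is [quintuple_telescope_step] times the common
   factor [c a b]; [tE] and [hE] eliminate [t] and [h']. *)
move: (q ^+ k) (q ^+ i) (q ^+ N) (ia k.+1) (ib i.+1) (cN N) => X Y Z a b c.
move: (quint_term j) (quint_head j) (quint_head (j + 1)) => t h h' tE hE main.
transitivity (Z * t * (c * a * b) *
  ((1 - q * X * Y) * (1 - q ^+ 2 * X * Y) *
                 (1 + u * q * Z) * (1 + v * q * Z) -
     (1 - q * X) * (1 - u ^+ 2 * q * X) * (1 - q * Y) * (1 - v ^+ 2 * q * Y))).
  by ring.
rewrite tE.
transitivity (h * (c * a * b) * ((Z - u * X) *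
  ((1 - q * X * Y) * (1 - q ^+ 2 * X * Y) *
                 (1 + u * q * Z) * (1 + v * q * Z) -
     (1 - q * X) * (1 - u ^+ 2 * q * X) * (1 - q * Y) * (1 - v ^+ 2 * q * Y)))).
  by ring.
rewrite main.
transitivity (- (Z * (h' * Y)) * (c * a * b) * ((1 - q * Y) * (1 - v ^+ 2 * q * Y) *
     ((1 - q * X) * (1 - v ^+ 2 * Y) +
      v ^+ 2 * (1 - q * X * Y) * (1 + u * q * Z))) +
  h * (c * a * b) * (Z * q * Y * (1 - q * X) * (1 - u ^+ 2 * q * X) *
     ((1 - X) * (1 - v ^+ 2 * q * Y) +
      v ^+ 2 * (1 - q * X * Y) * (1 + u * q * Z)))).
  by rewrite hE; ring.
by ring.
Qed.

(** Prepares the left end of the window in [quint_fin_sum]: the factor [1 + v q^(N+1)] completes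
    [1 - v q^(N+1)] to [1 - v^2 q^(2N+2)]. *)
Lemma quint_term_mirror N :
  quint_term (- N.+1%:Z) * (1 + v * q ^+ N.+1) =
  - (quint_head (- N%:Z) * q ^+ N.*2.+1 *
       (v ^+ 2 * (1 - v ^+ 2 * q ^+ N.*2.+2))).
Proof.
have -> : q ^+ N.*2.+2 = q ^+ N.+1 ^+ 2 by rewrite -exprM muln2 doubleS.
have p1 : (pent (- - N.+1%:Z) = pent (- N.+1%:Z) + N.+1)%N.
  have := omega_mul2 (- N.+1%:Z); have := omega_mul2 (- - N.+1%:Z).
  have := omega_ge0 (- N.+1%:Z); have := omega_ge0 (- - N.+1%:Z).
  by rewrite !sqrrN; lia.
have p2 : (pent (- N.+1%:Z) = pent (- - N%:Z) + N.*2.+1)%N.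
  have := omega_mul2 (- N.+1%:Z); have := omega_mul2 (- - N%:Z).
  have := omega_ge0 (- N.+1%:Z); have := omega_ge0 (- - N%:Z).
  by rewrite !sqrrN -muln2 !expr2; lia.
have v3 : up (3 * - N.+1%:Z) = up (3 * - N%:Z) * v ^+ 3.
  by rewrite !exprS expr0 mulr1 -!upD; congr up; lia.
have v2 : up (3 * - N.+1%:Z + 1) = up (3 * - N%:Z) * v ^+ 2.
  by rewrite !exprS expr0 mulr1 -!upD; congr up; lia.
rewrite /quint_term /quint_head v3 v2 p1 p2 !exprD.
by ring.
Qed.

(** From [N] to [N+1] the window grows by one index at each end. The interior changes by a
    difference of certificates, which the two new end terms cancel exactly. *)
Lemma quint_fin_sum N : \sum_(0 <= k < N.*2.+1) quint_fin N k = 1 - u.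
Proof.
elim: N => [|N IH].
  rewrite big_nat1 /quint_fin /quint_term /cN !qpoch0 ia0 ib0 !subrr.
  by rewrite !mulr0 oppr0 up0 add0r; ring.
rewrite doubleS big_nat_recr // big_nat_recl //= -{}IH.
have -> : \sum_(0 <= i < N.*2.+1) quint_fin N.+1 i.+1 =
  \sum_(0 <= i < N.*2.+1) quint_fin N i + (quint_cert N N.*2.+1 - quint_cert N 0).
  rewrite -telescope_sumr // -big_split /=; apply: eq_big_nat => i /andP[_ iN].
  by rewrite -quint_cert_step // addrCA subrr addr0.
have -> : quint_fin N.+1 0 = quint_cert N 0.
  rewrite /quint_fin /quint_cert !subn0 !sub0r ia0 cNS doubleS [ib N.*2.+1]ibS.
  rewrite expr0 subrr mul0r add0r.
  set m := quint_term _; set d := 1 - q ^+ N.*2.+2.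
  transitivity (m * (1 + v * q ^+ N.+1) * (cN N * ib N.*2.+2 *
    ((1 - q ^+ N.*2.+1) * d * (1 + u * q ^+ N.+1)))); first by ring.
  by rewrite quint_term_mirror; ring.
have -> : quint_fin N.+1 N.*2.+2 = - quint_cert N N.*2.+1.
  rewrite /quint_fin /quint_cert doubleS !subnn ib0 cNS [ia N.*2.+1]iaS expr0.
  have -> : N.*2.+2%:Z - N.+1%:Z = N.+1%:Z by rewrite -addnn; lia.
  have -> : N.*2.+1%:Z - N%:Z = N.+1%:Z by rewrite -addnn; lia.
  have := @quint_termM N.+1%:Z N.+1 0 ltac:(by rewrite subr0).
  rewrite expr0 mul1r => ->.
  have -> : q ^+ N.*2.+2 = q ^+ N.+1 ^+ 2 by rewrite -exprM muln2 doubleS.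
  by have := up_uv; move: u v => u' v' uv'; ring: uv'.
by ring.
Qed.

Lemma quint_term_small (j : int) n : (n <= `|j|)%N -> eqmodq n (quint_term j) 0.
Proof.
move=> nj; rewrite /quint_term ![up _ * _]mulrC -[0](subrr 0).
have := omega_ge_norm j; have := omega_ge_norm (- j).
by move=> h1 h2; apply: eqmodqB; apply: eqmodq_qX; lia.
Qed.

(** The limit of [quint_fin_sum]: modulo [q^K] the kernel of [quint_fin] can be replaced by the
    constant [D], and dividing by [D] gives the product. *)
Lemma quintuple_product K :
  eqmodq K (qpoch q K * ((1 - u) * rank_prod u v K))
           (\sum_(0 <= k < K.*2.*2.+1) quint_term (k%:Z - K.*2%:Z)).
Proof.
(* With [N = 2K], an index with [|k - N| < K] has both [k] and [2N - k] above [K], where the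
   Pochhammer symbols are stable modulo [q^K]. The other terms vanish modulo [q^K]. *)
set N := K.*2; pose qK := qpoch q K.
pose A := qpoch (u ^+ 2 * q) K; pose B := qpoch (v ^+ 2 * q) K.
pose U := qpoch (- u * q) K; pose V := qpoch (- v * q) K.
have uq : qK \is a GRing.unit by apply: qpoch_unit.
have uA : A \is a GRing.unit by rewrite qpoch_unit ?qcoef0_Mq.
have uB : B \is a GRing.unit by rewrite qpoch_unit ?qcoef0_Mq.
have uU : U \is a GRing.unit by rewrite qpoch_unit ?qcoef0_Mq.
have uV : V \is a GRing.unit by rewrite qpoch_unit ?qcoef0_Mq.
have KN : (K <= N)%N by rewrite /N -addnn leq_addr.
have trunc f m : qcoef 0 f = 0 -> (K <= m)%N -> eqmodq K (qpoch f m) (qpoch f K).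
  by move=> f0 Km; apply: eqmodq_leq (leqnSn K) (eqmodq_qpoch f0 Km).
pose D := U * V / (qK * A * B).
have SD : eqmodq K ((\sum_(0 <= k < N.*2.+1) quint_term (k%:Z - N%:Z)) * D)
                 (1 - u).
  rewrite -(quint_fin_sum N) mulr_suml big_nat_cond [X in eqmodq _ _ X]big_nat_cond.
  apply: eqmodq_sum => k /andP[/andP[_ kN] _].
  have [small|big] := leqP K `|k%:Z - N%:Z|%N.
    apply: (@eqmodq_trans _ _ 0).
      by rewrite -(mul0r D); apply: eqmodqMr; exact: quint_term_small.
    apply: eqmodq_sym; rewrite -(mul0r (cN N * ia k * ib (N.*2 - k))).
    by apply: eqmodqMr; exact: quint_term_small.
  apply: eqmodqMl; apply: eqmodq_sym.
  have -> : D = qK * U * V * (qK * A)^-1 * (qK * B)^-1.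
    exact: div_split_unit.
  apply: eqmodqM; [apply: eqmodqM|].
  - by apply: eqmodqM; [apply: eqmodqM|]; apply: trunc;
       rewrite ?qcoef0_Mq // (leq_trans KN) // -addnn leq_addr.
  - apply: eqmodqV; rewrite ?unitrM ?uq ?uA ?qpoch_unit ?qcoef0_Mq //.
    by apply: eqmodqM; apply: trunc; rewrite ?qcoef0_Mq //;
       rewrite /N -addnn in big *; lia.
  apply: eqmodqV; rewrite ?unitrM ?uq ?uB ?qpoch_unit ?qcoef0_Mq //.
  by apply: eqmodqM; apply: trunc; rewrite ?qcoef0_Mq //;
     rewrite /N -!addnn in big kN *; lia.
have uD : D \is a GRing.unit by rewrite /D !(unitrM, unitrV) uU uV uq uA uB.
have -> : qpoch q K * ((1 - u) * rank_prod u v K) = (1 - u) * D^-1.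
  by rewrite /rank_prod /D -/qK -/A -/B -/U -/V div_inv_unit ?unitrM ?uq ?uA ?uU //; ring.
have := eqmodqMr D^-1 SD; rewrite mulrK // => h; exact: eqmodq_sym.
Qed.

End Quintuple.

(** * Overpartitions and their pairs *)

(** The bound on the weight is an inequality so that one list serves both members of a pair of total
    weight [n]. *)
Definition ovparts (n : nat) : seq (seq part) :=
  fset_set [set s | overpartition s /\ (weight s <= n)%N]%classic.

Lemma mem_ovparts n s : (s \in ovparts n) = overpartition s && (weight s <= n)%N.
Proof.
rewrite /ovparts in_fset_set; last exact: overpartition_finite.
by apply/idP/idP => [/set_mem/andP//|/andP h]; exact/mem_set.
Qed.

Lemma ovparts_uniq n : uniq (ovparts n).
Proof. exact: fset_uniq. Qed.

Lemma weight_cons x s : weight (x :: s) = (x.1 + weight s)%N.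
Proof. by rewrite /weight big_cons. Qed.

Lemma part_le_weight s : all (fun x : part => x.1 <= weight s)%N s.
Proof.
apply/allP => x xs; rewrite /weight (big_rem x) //=; exact: leq_addr.
Qed.

Definition part_gt : rel part :=
  fun x y => ((y.1 < x.1) || ((y.1 == x.1) && ~~ y.2))%N.

Lemma part_gt_trans : transitive part_gt.
Proof. by rewrite /part_gt => -[b ?] [a []] [c []] /=; lia. Qed.

Lemma overpartition_cons x s :
  overpartition (x :: s) = [&& (0 < x.1)%N, all (part_gt x) s & overpartition s].
Proof.
rewrite /overpartition /= -/part_gt (path_sortedE part_gt_trans).
by rewrite -!andbA; congr (_ && _); rewrite andbCA.
Qed.

Lemma overpartition_head x s : overpartition (x :: s) ->
  all (fun y : part => y.1 <= x.1)%N s.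
Proof.
rewrite overpartition_cons => /and3P[_ + _]; apply: sub_all => y.
by rewrite /part_gt; lia.
Qed.

(** * Generating functions of overpartitions with bounded parts *)

Section OverpartitionSeries.
Variables (R : comNzRingType) (a b : R).
Local Notation q := (fpsq : fps R).

Definition ov_monomial (s : seq part) : R :=
  a ^+ overlined s * b ^+ nonoverlined s.

Definition ov_series (P : pred (seq part)) : fps R :=
  Fps (fun n => \sum_(s <- ovparts n | P s && (weight s == n)) ov_monomial s).

Lemma ov_seriesE (P : pred (seq part)) n : qcoef n (ov_series P) =
  \sum_(s <- ovparts n | P s && (weight s == n)) ov_monomial s.
Proof. by []. Qed.

Lemma sum_ovparts_leq (G : seq part -> R) (P : pred (seq part)) m n :
  (m <= n)%N -> \sum_(s <- ovparts n | P s && (weight s == m)) G s =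
  \sum_(s <- ovparts m | P s && (weight s == m)) G s.
Proof.
move=> mn; rewrite -big_filter -[RHS]big_filter; apply: perm_big.
apply: uniq_perm; rewrite ?filter_uniq ?ovparts_uniq // => s.
rewrite !mem_filter !mem_ovparts; case: eqP => [->|_]; last by rewrite andbF.
by rewrite mn leqnn.
Qed.

Lemma ov_series_ext (P Q : pred (seq part)) :
  (forall s, overpartition s -> P s = Q s) -> ov_series P = ov_series Q.
Proof.
move=> PQ; apply: fpsP => n; rewrite !ov_seriesE big_seq_cond [RHS]big_seq_cond.
apply: eq_bigl => s; rewrite mem_ovparts.
by case: (boolP (overpartition s)) => //= /PQ ->.
Qed.

Lemma ov_series_split (P B : pred (seq part)) : ov_series P =
  ov_series (fun s => P s && B s) + ov_series (fun s => P s && ~~ B s).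
Proof.
apply: fpsP => n; rewrite qcoefD !ov_seriesE (bigID B) /=.
by congr (_ + _); apply: eq_bigl => s; rewrite andbAC.
Qed.

(** Removing the first part is a bijection onto the overpartitions that [x] may precede. *)
Lemma ov_series_head (P : pred (seq part)) (x : part) :
  ov_series (fun s => P s && (ohead s == Some x)) =
  fpsC (ov_monomial [:: x]) * q ^+ x.1 *
    ov_series (fun s => P (x :: s) && overpartition (x :: s)).
Proof.
apply: fpsP => n; rewrite -mulrA qcoefCM qcoef_qXM ov_seriesE.
case: ltnP => [nx|xn].
  rewrite mulr0 big1_seq // => -[|y s] /andP[/andP[/andP[_ /eqP //= [->]]]].
  by rewrite weight_cons; lia.
rewrite ov_seriesE mulr_sumr -big_filter -[in RHS]big_filter.
rewrite [RHS](eq_bigr (fun s => ov_monomial (x :: s))); last first.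
  move=> s _; rewrite /ov_monomial /overlined /nonoverlined /= !exprD.
  by ring.
rewrite -[RHS](big_map (cons x) xpredT); apply: perm_big.
apply: uniq_perm; rewrite ?map_inj_uniq ?filter_uniq ?ovparts_uniq //.
  by move=> ? ? [].
move=> s; apply/idP/mapP.
  rewrite mem_filter mem_ovparts => /andP[/andP[/andP[Ps]]].
  case: s Ps => [//|y s] Ps /= /eqP[yx]; rewrite {}yx in Ps *.
  rewrite weight_cons => /eqP wn /andP[ovs _]; exists s => //.
  rewrite mem_filter mem_ovparts Ps ovs /= -wn addKn eqxx leqnn andbT.
  by move: ovs; rewrite overpartition_cons => /and3P[].
case=> s'; rewrite mem_filter => /andP[/andP[/andP[Ps ovs] /eqP wn] _] ->.
rewrite mem_filter mem_ovparts Ps ovs /= eqxx weight_cons wn subnKC //.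
by rewrite eqxx leqnn.
Qed.

Definition parts_le N : pred (seq part) := all (fun y : part => y.1 <= N)%N.
(** The parts below the overlined [N]: an intermediate class, obtained from parts at most [N - 1] by
    allowing non-overlined copies of [N]. *)
Definition parts_lt_ov N : pred (seq part) :=
  fun s => parts_le N s && ((N, true) \notin s).

Lemma parts_le_cons N o s : overpartition s ->
  overpartition ((N.+1, o) :: s) && parts_le N.+1 s = parts_lt_ov N.+1 s.
Proof.
move=> os; rewrite overpartition_cons os andbT /= /parts_lt_ov /parts_le.
rewrite -has_pred1 -all_predC -all_predI -all_predI.
apply: eq_all => -[k o'] /=; rewrite /part_gt /= xpair_eqE.
by case: o'; lia.
Qed.

Lemma parts_le0 s : overpartition s -> parts_le 0 s = (s == [::]).
Proof.
case: s => [|[k o] s] //; rewrite overpartition_cons /= => /and3P[k0 _ _].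
by rewrite leqNgt k0.
Qed.

Lemma parts_le_noN N s : overpartition s ->
  parts_lt_ov N.+1 s && (ohead s != Some (N.+1, false)) = parts_le N s.
Proof.
case: s => [|[k o] s] // os; rewrite /parts_lt_ov /=.
have /= le := overpartition_head os.
apply/idP/idP.
  rewrite inE negb_or => /andP[/andP[/andP[kN _] /andP[k1 _]] k2].
  have kN' : (k <= N)%N.
    rewrite leqNgt; apply/negP => Nk; have kE : k = N.+1 by lia.
    by rewrite kE in k1 k2; case: o {os} k1 k2; rewrite eqxx.
  by rewrite kN' /=; apply: sub_all le => y /leq_trans; exact.
case/andP=> kN sN; rewrite (leq_trans kN) //=.
apply/andP; split; last by apply/eqP => -[kE _]; rewrite kE ltnn in kN.
apply/andP; split; first by apply: sub_all sN => y /leq_trans; apply.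
rewrite inE negb_or xpair_eqE; apply/andP; split.
  by apply/negP => /andP[/eqP kE _]; rewrite -kE ltnn in kN.
by apply/negP => /(allP sN) /=; rewrite ltnn.
Qed.

Lemma parts_le_noov N s : overpartition s ->
  parts_le N s && (ohead s != Some (N, true)) = parts_lt_ov N s.
Proof.
rewrite /parts_lt_ov; case: s => [|[k o] s] // os /=.
case: (boolP ((k <= N)%N && parts_le N s)) => //= /andP[kN _].
have -> : (Some (k, o) != Some (N, true)) = ((N, true) != (k, o)).
  by rewrite eq_sym.
rewrite inE negb_or; case: eqP => //= _; apply/esym/negP => Ns.
move: os; rewrite overpartition_cons => /and3P[_ /allP /(_ _ Ns)].
by rewrite /part_gt /= ltnNge kN andbF.
Qed.

Local Notation A N := (ov_series (parts_le N)).
Local Notation A' N := (ov_series (parts_lt_ov N)).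

Lemma ov_monomial1 k o : ov_monomial [:: (k, o)] = if o then a else b.
Proof. by case: o; rewrite /ov_monomial /= expr0 expr1 ?mulr1 ?mul1r. Qed.

Lemma ov_series_le0 : A 0 = 1.
Proof.
apply: fpsP => n; rewrite ov_seriesE qcoef1.
rewrite big_seq_cond (eq_bigl (fun s => (s \in ovparts n) && ((s == [::]) && (n == 0%N)))).
  rewrite -big_seq_cond; case: eqP => [->|_].
    rewrite (eq_bigl (pred1 [::])); last by move=> s; rewrite andbT.
    rewrite -big_filter filter_pred1_uniq ?ovparts_uniq ?mem_ovparts //.
      by rewrite big_seq1 /ov_monomial /= !expr0 mulr1.
    by rewrite /weight big_nil.
  by rewrite big_pred0 // => s; rewrite andbF.
move=> s; rewrite mem_ovparts; case: (boolP (overpartition s)) => //= os.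
rewrite parts_le0 //; case: eqP => [->|_] //=.
by rewrite /weight big_nil eq_sym; case: n.
Qed.

(** Peeling off a leading non-overlined [N+1] stays in the same class, which yields a geometric
    series. *)
Lemma ov_series_lt_ovS N : A' N.+1 * (1 - fpsC b * q ^+ N.+1) = A N.
Proof.
have E : A' N.+1 = fpsC b * q ^+ N.+1 * A' N.+1 + A N.
  rewrite {1}(ov_series_split _ (fun s => ohead s == Some (N.+1, false))).
  rewrite ov_series_head ov_monomial1; congr (_ * _ + _).
    apply: ov_series_ext => s os.
    have -> : parts_lt_ov N.+1 ((N.+1, false) :: s) = parts_lt_ov N.+1 s.
      by rewrite /parts_lt_ov /= leqnn inE xpair_eqE andbF.
    rewrite -(parts_le_cons N false os).
    by case: (overpartition (_ :: _)); rewrite ?andbT ?andbF.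
  by apply: ov_series_ext => s /parts_le_noN.
by rewrite mulrBr mulr1 {1}E; ring.
Qed.

(** The overlined [N+1] occurs at most once, necessarily as the first part. *)
Lemma ov_series_leS N : A N.+1 = A' N.+1 * (1 + fpsC a * q ^+ N.+1).
Proof.
rewrite (ov_series_split _ (fun s => ohead s == Some (N.+1, true))).
rewrite ov_series_head ov_monomial1 mulrDr mulr1 addrC mulrC; congr (_ + _ * _).
  by apply: ov_series_ext => s /parts_le_noov.
apply: ov_series_ext => s os.
by rewrite -(parts_le_cons N true os) /= leqnn andbC.
Qed.

Lemma ov_series_le N :
  A N * qpoch (fpsC b * q) N = qpoch (- fpsC a * q) N.
Proof.
elim: N => [|N IH]; first by rewrite ov_series_le0 !qpoch0 mul1r.
rewrite !qpochS ov_series_leS -IH -(ov_series_lt_ovS N) exprS; ring.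
Qed.

End OverpartitionSeries.

(** * The largest part of a pair and [chi] *)

Lemma pair_part_leE (k l : nat) (o o' : bool) :
  (((k, (o, o')) : pair_part) <= (l, (false, false)))%O =
  (k < l)%N || [&& k == l, ~~ o & ~~ o'].
Proof.
rewrite !Order.ProdLexiOrder.leEprodlexi /= !leEnat !leEbool.
by case: o o' => -[]; rewrite /= ?orbF ?implybF ?implybT; lia.
Qed.

Lemma largest_leq la mu N :
  (largest la mu <= N)%N = parts_le N la && parts_le N mu.
Proof.
rewrite /parts_le -all_cat /largest; apply/bigmax_leqP_seq/allP => h x xs.
  exact: h.
by move=> _; exact: h.
Qed.

Lemma largest_eq la mu N :
  parts_le N.+1 la && parts_le N.+1 mu -> ~~ (parts_le N la && parts_le N mu) ->
  largest la mu = N.+1.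
Proof. by rewrite -!largest_leq; lia. Qed.

Lemma mem_pair_parts la mu k o o' : ((k, (o, o')) : pair_part) \in pair_parts la mu =
  if o then (k, o') \in la else (k, o') \in mu.
Proof.
rewrite /pair_parts mem_cat; apply/orP/idP.
  by case=> /mapP[[k' o''] h [-> -> ->]].
by case: o => h; [left|right]; apply/mapP; exists (k, o').
Qed.

(** When the largest size is [N+1], [chi] holds iff this size occurs only as non-overlined parts of
    [mu]. This expresses [chi] by the classes whose generating functions are known. *)
Lemma chiE la mu N :
  parts_le N.+1 la && parts_le N.+1 mu -> ~~ (parts_le N la && parts_le N mu) ->
  chi la mu = parts_le N la && parts_lt_ov N.+1 mu.
Proof.
move=> /andP[la1 mu1] nle; apply/hasP/andP => [[[k [o o']] xin]|[la0]].
  case/andP=> /= /eqP[oE oE'] /allP le; subst o o'.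
  have kN : (k <= N.+1)%N.
    by move: xin; rewrite mem_pair_parts => /(allP mu1).
  have bound o1 o2 (l : nat) : (l, (o1, o2)) \in pair_parts la mu ->
     (l < k)%N || [&& l == k, ~~ o1 & ~~ o2].
    by move=> /le; rewrite pair_part_leE.
  have ltla : parts_le N la.
    apply/allP => -[l o] lin /=.
    by have := bound true o l; rewrite mem_pair_parts => /(_ lin); lia.
  split=> //; rewrite /parts_lt_ov mu1 /=; apply/negP => Nmu.
  by have := bound false true N.+1; rewrite mem_pair_parts => /(_ Nmu); lia.
case/andP=> _ Nmu.
have /allPn[[l o] lin /= Nl] : ~~ parts_le N mu by rewrite la0 in nle.
have lE : l = N.+1 by have /= := allP mu1 _ lin; lia.
rewrite lE in lin Nl; have oE : o = false by case: o lin Nmu => // ->.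
exists (N.+1, (false, false)); first by rewrite mem_pair_parts -oE.
rewrite eqxx /=; apply/allP => -[k [o1 o2]].
rewrite mem_pair_parts pair_part_leE; case: o1 => kin.
  by have /= := allP la0 _ kin; rewrite ltnS => ->.
have /= := allP mu1 _ kin; rewrite leq_eqVlt => /orP[/eqP kE|]; last by move=> ->.
rewrite kE eqxx in kin *; case: o2 kin => kin; last by rewrite orbT.
by rewrite kin in Nmu.
Qed.

(** * Generating functions of overpartition pairs by rank *)

Section PairSeries.
Variables (R : comNzRingType) (y a b a' b' : R).
Local Notation q := (fpsq : fps R).
Implicit Type G : seq part -> seq part -> R.

Definition pair_series G : fps R :=
  Fps (fun n => \sum_(la <- ovparts n)
    \sum_(mu <- ovparts n | (weight la + weight mu == n)%N) G la mu).

Lemma pair_seriesE G n : qcoef n (pair_series G) =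
  \sum_(la <- ovparts n)
    \sum_(mu <- ovparts n | (weight la + weight mu == n)%N) G la mu.
Proof. by []. Qed.

Lemma eq_qcoef_pair_series G H n :
  (forall la mu, overpartition la -> overpartition mu ->
     (weight la + weight mu)%N = n -> G la mu = H la mu) ->
  qcoef n (pair_series G) = qcoef n (pair_series H).
Proof.
move=> GH; rewrite !pair_seriesE; apply: eq_big_seq => la.
rewrite mem_ovparts => /andP[ola _]; rewrite big_seq_cond [RHS]big_seq_cond.
apply: eq_bigr => mu /andP[]; rewrite mem_ovparts => /andP[omu _] /eqP.
exact: GH.
Qed.

Lemma eq_pair_series G H :
  (forall la mu, overpartition la -> overpartition mu -> G la mu = H la mu) ->
  pair_series G = pair_series H.
Proof.
by move=> GH; apply: fpsP => n; apply: eq_qcoef_pair_series => la mu ? ? _; exact: GH.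
Qed.

Lemma pair_seriesD G H :
  pair_series (fun la mu => G la mu + H la mu) = pair_series G + pair_series H.
Proof.
apply: fpsP => n; rewrite qcoefD !pair_seriesE -big_split.
by apply: eq_bigr => la _; rewrite big_split.
Qed.

Lemma pair_seriesZ c G :
  pair_series (fun la mu => c * G la mu) = fpsC c * pair_series G.
Proof.
apply: fpsP => n; rewrite qcoefCM !pair_seriesE mulr_sumr.
by apply: eq_bigr => la _; rewrite mulr_sumr.
Qed.

Lemma pair_seriesB G H :
  pair_series (fun la mu => G la mu - H la mu) = pair_series G - pair_series H.
Proof.
rewrite pair_seriesD; congr (_ + _); apply: fpsP => n.
rewrite qcoefN !pair_seriesE -sumrN.
by apply: eq_bigr => la _; rewrite sumrN.
Qed.

Definition pair_monomial la mu := ov_monomial a b la * ov_monomial a' b' mu.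

Definition pair_class (P Q : pred (seq part)) la mu : R :=
  (P la && Q mu)%:R * pair_monomial la mu.

Lemma ov_seriesM (P Q : pred (seq part)) :
  ov_series a b P * ov_series a' b' Q = pair_series (pair_class P Q).
Proof.
apply: fpsP => n; rewrite qcoefM pair_seriesE.
rewrite [RHS](eq_bigr (fun la => if P la then ov_monomial a b la *
  \sum_(mu <- ovparts n | Q mu && (weight mu + weight la == n)%N)
      ov_monomial a' b' mu else 0)); last first.
  move=> la _; case: ifP => Pla; last first.
    by rewrite big1 // => mu _; rewrite /pair_class Pla mul0r.
  rewrite mulr_sumr [RHS]big_mkcondl.
  apply: eq_big => [mu|mu _]; first by rewrite addnC.
  rewrite /pair_class Pla /=.
  by case: (Q mu); rewrite ?mul1r ?mul0r.
rewrite -big_mkcond /=.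
(* Pairs are grouped by the weight of [la], at most [n] on [ovparts n], so [inord] loses nothing. *)
rewrite [RHS]big_seq_cond [RHS](partition_big (fun la => inord (weight la) : 'I_n.+1) xpredT) //=.
apply: eq_bigr => i _; have iN : (i <= n)%N by rewrite -ltnS.
rewrite !ov_seriesE -(sum_ovparts_leq _ _ iN).
rewrite -[X in _ * X](sum_ovparts_leq _ _ (leq_subr i n)) mulr_suml.
rewrite [LHS]big_seq_cond; apply: congr_big => // la.
  rewrite mem_ovparts; case: (boolP (overpartition la)) => //= _.
  case: leqP => //= wn; case: (P la) => //=.
  by rewrite -val_eqE /= inordK.
rewrite mem_ovparts => /andP[_ /andP[_ /eqP wi]]; congr (_ * _).
apply: eq_bigl => mu; congr (_ && _); rewrite wi; lia.
Qed.

(* The natural subtraction is exact on pairs of overpartitions, by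
   [chi_leq_largest]. *)
Definition rank_monomial la mu : R :=
  y ^+ (largest la mu - chi la mu) * pair_monomial la mu.

Definition bounded_rank_series N : fps R :=
  pair_series (fun la mu =>
    (parts_le N la && parts_le N mu)%:R * rank_monomial la mu).

(** A pair of total weight at most [N] has no part above [N]. *)
Lemma eqmodq_bounded_rank_series N :
  eqmodq N.+1 (bounded_rank_series N) (pair_series rank_monomial).
Proof.
apply/eqmodqP => n nN; apply: eq_qcoef_pair_series => la mu _ _ wn.
have wlt s : (weight s <= n)%N -> parts_le N s.
  move=> sn; apply: sub_all (part_le_weight s) => x /leq_trans; apply.
  by rewrite (leq_trans sn).
by rewrite !wlt ?mul1r // -wn ?leq_addr ?leq_addl.
Qed.

Lemma parts_leW N s : parts_le N s -> parts_le N.+1 s.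
Proof. by apply: sub_all => x /leq_trans; apply. Qed.

Lemma parts_leN N s : parts_le N s -> parts_lt_ov N.+1 s.
Proof.
move=> sN; rewrite /parts_lt_ov parts_leW //=; apply/negP => /(allP sN) /=.
by rewrite ltnn.
Qed.

(** A new pair has largest part [N+1], so its exponent of [y] is [N] if [chi] holds and [N+1]
    otherwise. By [chiE] the two kinds are the successive differences of three nested classes. *)
Lemma rank_monomial_step N la mu :
  (parts_le N.+1 la && parts_le N.+1 mu)%:R * rank_monomial la mu =
  (parts_le N la && parts_le N mu)%:R * rank_monomial la mu +
  y ^+ N.+1 * (pair_class (parts_le N.+1) (parts_le N.+1) la mu -
               pair_class (parts_le N) (parts_lt_ov N.+1) la mu) +
  y ^+ N * (pair_class (parts_le N) (parts_lt_ov N.+1) la mu -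
            pair_class (parts_le N) (parts_le N) la mu).
Proof.
rewrite /pair_class.
have [le0|nle] := boolP (parts_le N la && parts_le N mu).
  have /andP[la0 mu0] := le0.
  by rewrite !parts_leW // parts_leN // la0; ring.
have [le1|nle1] := boolP (parts_le N.+1 la && parts_le N.+1 mu); last first.
  suff -> : parts_le N la && parts_lt_ov N.+1 mu = false by ring.
  apply: contraNF nle1 => /andP[la0 /andP[-> _]].
  by rewrite parts_leW.
rewrite /rank_monomial (largest_eq le1 nle) (chiE le1 nle).
by case: (_ && _); rewrite ?subn1 ?subn0 /=; ring.
Qed.

Lemma bounded_rank_seriesS N :
  bounded_rank_series N.+1 = bounded_rank_series N +
  fpsC (y ^+ N.+1) *
    (ov_series a b (parts_le N.+1) * ov_series a' b' (parts_le N.+1) -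
     ov_series a b (parts_le N) * ov_series a' b' (parts_lt_ov N.+1)) +
  fpsC (y ^+ N) *
    (ov_series a b (parts_le N) * ov_series a' b' (parts_lt_ov N.+1) -
     ov_series a b (parts_le N) * ov_series a' b' (parts_le N)).
Proof.
rewrite !ov_seriesM -!pair_seriesB -!pair_seriesZ -!pair_seriesD.
by apply: eq_pair_series => la mu _ _; rewrite rank_monomial_step.
Qed.

Lemma bounded_rank_series0 : bounded_rank_series 0 = 1.
Proof.
rewrite -[RHS]mulr1 -{1}(ov_series_le0 a b) -(ov_series_le0 a' b') ov_seriesM.
apply: eq_pair_series => la mu ola omu; rewrite /pair_class /rank_monomial.
have [le0|] := boolP (_ && _); last by rewrite !mul0r.
move: le0; rewrite !parts_le0 // => /andP[/eqP -> /eqP ->].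
by rewrite /largest big_nil sub0n expr0 !mul1r.
Qed.

(** The hypotheses hold for the rank weights [a = d/y], [b = 1/y], [a' = e/y], [b' = d e]; the
    quadratic terms in [q^(N+1)] then cancel and the increment factors with [(1 + d)(1 + e)]. *)
Lemma bounded_rank_series_diff N : y * b = 1 -> b' = y * a * (y * a') ->
  bounded_rank_series N.+1 = bounded_rank_series N +
  fpsC ((1 + y * a) * (1 + y * a') * y ^+ N) * q ^+ N.+1 *
    (ov_series a b (parts_lt_ov N.+1) * ov_series a' b' (parts_lt_ov N.+1)).
Proof.
move=> yb bE; rewrite bounded_rank_seriesS !ov_series_leS -!(ov_series_lt_ovS _ _ N).
have yb' : fpsC y * fpsC b = 1 by rewrite -fpsCM yb.
have bE' : fpsC b' = fpsC y * fpsC a * (fpsC y * fpsC a').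
  by rewrite bE !fpsCM.
rewrite exprS !fpsCM !fpsCD !fpsCM !fpsC1 bE' -[LHS]addrA.
congr (_ + _).
move: (ov_series _ _ _) (ov_series _ _ _) (fpsC (y ^+ N)) (q ^+ N.+1) => s t p Q.
by ring: yb'.
Qed.

End PairSeries.

(** * Coefficients in z *)

Section LaurentFacts.
Variable R : comNzRingType.
Implicit Types f g : laurent R.

Lemma zcoefD k f g : zcoef k (f + g) = zcoef k f + zcoef k g.
Proof. exact: zcoef_add. Qed.

Lemma zcoefN k f : zcoef k (- f) = - zcoef k f.
Proof. exact: zcoef_opp. Qed.

Lemma zcoef0 k : zcoef k (0 : laurent R) = 0.
Proof. exact: zcoef_0. Qed.

Lemma zcoef_sum k (I : Type) (r : seq I) (P : pred I) (F : I -> laurent R) :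
  zcoef k (\sum_(i <- r | P i) F i) = \sum_(i <- r | P i) zcoef k (F i).
Proof. by apply: (big_morph (zcoef k)); [exact: zcoefD|exact: zcoef0]. Qed.

Lemma zcoef_lmonM a k f : zcoef k (lmon a * f) = zcoef (k - a) f.
Proof. exact: zcoef_monM. Qed.

Lemma lmon0 : lmon 0 = 1 :> laurent R.
Proof. by []. Qed.

Lemma lmonD a b : lmon (a + b) = lmon a * lmon b :> laurent R.
Proof.
by apply/laurentP => k; rewrite zcoef_lmonM !zcoef_mon -subr_eq0 -[in RHS]subr_eq0
  opprD addrA addrAC.
Qed.

Lemma lmonX a n : lmon a ^+ n = lmon (a * n%:Z) :> laurent R.
Proof.
elim: n => [|n IH]; first by rewrite mulr0.
by rewrite exprS IH -lmonD; congr lmon; lia.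
Qed.

Lemma zcoef_signM k n f : zcoef k ((-1) ^+ n * f) = (-1) ^+ n * zcoef k f.
Proof.
by rewrite -signr_odd -[in RHS]signr_odd; case: odd;
  rewrite /= ?expr0 ?expr1 ?mul1r ?mulN1r ?zcoefN.
Qed.

Lemma zcoef_far f : exists M : int, forall k, k <= M -> zcoef k f = 0.
Proof.
exists (- \sum_(i <- finsupp (lfun f)) `|i| - 1) => k kM.
apply: zcoef_out; apply/negP => kf; move: kM.
rewrite (big_rem k) //=; set s := \sum_(_ <- _) _.
have s0 : 0 <= s by apply: sumr_ge0.
lia.
Qed.

End LaurentFacts.

(** Two consecutive zeros propagate to the right. This serves both to cancel [z - 1 + 1/z] and to
    identify the coefficients with their closed form. *)
Lemma recurrence_zero (V : zmodType) (d : int -> V) :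
  (exists M : int, forall k, k <= M -> d k = 0) ->
  (forall k, d (k - 1) - d k + d (k + 1) = 0) -> forall k, d k = 0.
Proof.
move=> [M dM] rec k.
have [kM|Mk] := leP k M; first exact: dM.
have -> : k = M + `|k - M|%N by lia.
suff : forall n : nat, d (M + n%:Z) = 0 /\ d (M + n%:Z - 1) = 0.
  by move=> /(_ `|k - M|%N)[].
elim=> [|n [IH1 IH2]]; first by rewrite addr0 !dM //; lia.
have := rec (M + n%:Z); rewrite IH1 IH2 subr0 add0r => e.
by split; [rewrite -addn1 PoszD addrA|rewrite -addn1 PoszD addrA addrK].
Qed.

(** * The signed count of overpartition pairs over Laurent polynomials *)

Section LaurentSpecialization.

Local Notation L := (laurent int).

Lemma zcoef_three (f : L) k :
  zcoef k ((lmon 1 - 1 + lmon (-1)) * f) =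
  zcoef (k - 1) f - zcoef k f + zcoef (k + 1) f.
Proof.
by rewrite !mulrDl mulNr mul1r !zcoefD zcoefN !zcoef_lmonM opprK.
Qed.

(** The coefficients of an element killed by [z - 1 + 1/z] satisfy the recurrence and vanish far to
    the left. *)
Lemma three_reg : injective (GRing.mul (lmon 1 - 1 + lmon (-1) : L)).
Proof.
move=> f g fg; apply/eqP; rewrite -subr_eq0; apply/eqP/laurentP => k.
rewrite zcoef0; move: k; apply: recurrence_zero; first exact: zcoef_far.
by move=> k; rewrite -zcoef_three mulrBr fg subrr zcoef0.
Qed.

Lemma zpow0 : zpow 0 = 1. Proof. by []. Qed.

Lemma zpowD a b : zpow (a + b) = zpow a * zpow b.
Proof. by rewrite /zpow lmonD fpsCM. Qed.

Local Notation q := (fpsq : fps L).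
Local Notation u := (zpow 1).
Local Notation v := (zpow (-1)).

Lemma zpow_uv : u * v = 1.
Proof. by rewrite -zpowD. Qed.

Lemma zpow_three : u - 1 + v = fpsC (lmon 1 - 1 + lmon (-1)).
Proof. by rewrite !fpsCD fpsCN. Qed.

Lemma zpow_three_reg : injective (GRing.mul (u - 1 + v)).
Proof.
move=> f g fg; apply: fpsP => n; apply: three_reg.
by have := congr1 (qcoef n) fg; rewrite zpow_three !qcoefCM.
Qed.

(* The weight [d^r e^s y^rank] for [d = - z^-2], [e = - z^2] and [y = - z]: an
   overlined part of [lambda] contributes [d / y], a non-overlined one [1 / y],
   an overlined part of [mu] contributes [e / y], a non-overlined one [d e]. *)
Definition signed_monomial : seq part -> seq part -> L :=
  rank_monomial (- lmon 1) (lmon (-3)) (- lmon (-1)) (lmon 1) 1.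

Lemma div_cancel_mul (F : comUnitRingType) (t n c d e f : F) :
  c * d \is a GRing.unit -> t * (n / (c * d)) * (e * c * (f * d)) = n * (t * (e * f)).
Proof.
move=> /mulVr; move: ((c * d)^-1) => i icd.
by rewrite -[RHS]mulr1 -icd; ring.
Qed.

(** The usual shape of a [2phi1] term, with denominators cleared. *)
Lemma gauss_term_closed (R : comNzRingType) (x y : fps R) N :
  gauss_term x y 0 N * (qpoch fpsq N * qpoch (- y * fpsq) N) =
  qpoch (- y ^+ 3) N * qpoch (- x) N * (- x * fpsq) ^+ N.
Proof.
elim: N => [|N IH]; first by rewrite /gauss_term big_geq // !qpoch0 expr0 !mulr1.
rewrite gauss_termS !qpochS [(_ * _) ^+ N.+1]exprS.
have U1 : 1 - (fpsq : fps R) * fpsq ^+ N \is a GRing.unit.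
  by apply: fps_unit_sub1; rewrite qcoef0M qcoef0_q mul0r.
have U2 : 1 - - y * fpsq * fpsq ^+ N \is a GRing.unit.
  by apply: fps_unit_sub1; rewrite qcoef0M qcoef0_Mq mul0r.
have -> : gauss_factor x y 0 N = (1 - - y ^+ 3 * fpsq ^+ N) * (1 - - x * fpsq ^+ N) *
   (- x * fpsq) / ((1 - fpsq * fpsq ^+ N) * (1 - - y * fpsq * fpsq ^+ N)).
  by rewrite /gauss_factor !expr1 -exprS !mulNr !opprK.
transitivity ((1 - - y ^+ 3 * fpsq ^+ N) * (1 - - x * fpsq ^+ N) *
   (- x * fpsq) * (gauss_term x y 0 N * (qpoch fpsq N * qpoch (- y * fpsq) N))).
  by apply: div_cancel_mul; rewrite unitrM U1.
by rewrite IH; ring.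
Qed.

(** Raising the bound on the parts by one adds exactly one q-Gauss term. The factors agree because
    [u (1 + v^3) = (1 + v)(u - 1 + v)] when [u v = 1]. *)
Lemma bounded_rank_gauss N :
  (u - 1 + v) *
    bounded_rank_series (- lmon 1) (lmon (-3)) (- lmon (-1)) (lmon 1) 1 N =
  1 - (1 - u) * (1 - v) * (\sum_(0 <= k < N.+1) gauss_term u v 0 k).
Proof.
elim: N => [|N IH].
  rewrite bounded_rank_series0 big_nat1 /gauss_term big_geq // !mulr1.
  by rewrite mulrBl mul1r mulrBr mulr1 zpow_uv; ring.
rewrite bounded_rank_series_diff; last 2 first.
- by rewrite mulrNN -lmonD.
- by rewrite !mulNr mulrN opprK -!lmonD.
rewrite mulrDr IH [in RHS]big_nat_recr //=.
have A1 := ov_series_lt_ovS (lmon (-3) : L) (- lmon (-1)) N.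
have A2 := ov_series_lt_ovS (lmon 1 : L) 1 N.
have B1 := ov_series_le (lmon (-3) : L) (- lmon (-1)) N.
have B2 := ov_series_le (lmon 1 : L) 1 N.
have gt := gauss_term_closed u v N.+1.
move: A1 A2 B1 B2; set s1 := ov_series _ _ (parts_lt_ov _).
set s2 := ov_series _ _ (parts_lt_ov _) => <- <-.
have v3 : fpsC (lmon (-3)) = v ^+ 3 by rewrite !exprS expr0 mulr1 -!zpowD.
rewrite fpsC1 fpsCN v3 -/(zpow 1) -/(zpow (-1)) !mul1r => B1 B2.
(* The numerators are split on the left, which isolates [(1 + v^3)(1 + u)]; by [ov_series_le] the
   remaining Pochhammer quotient is [s1 s2]. *)
have {}gt : gauss_term u v 0 N.+1 =
   - u * (1 + v ^+ 3) * (1 + u) * ((- u) ^+ N * q ^+ N.+1 * (s1 * s2)).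
  have U : qpoch q N.+1 * qpoch (- v * q) N.+1 \is a GRing.unit.
    rewrite unitrM; apply/andP; split.
      exact: qpoch_unit (qcoef0_q _).
    exact: qpoch_unit (qcoef0_Mq _).
  apply: (mulIr U).
  apply: (etrans gt).
  rewrite [qpoch (- v ^+ 3) _]qpochSl [qpoch (- u) _]qpochSl.
  rewrite [qpoch q _]qpochS [qpoch (- v * q) _]qpochS.
  rewrite -B1 -B2 exprMn [(- u) ^+ N.+1]exprS [q ^+ N.+1]exprS.
  clear; move: (qpoch q N) (qpoch (- v * q) N) (q ^+ N) ((- u) ^+ N) => Q1 Q2 Q3 Q4.
  move: (zpow 1) (zpow (-1)) (fpsq) => u' v' q'.
  by clearbody s1 s2; ring.
rewrite gt; set S := \sum_(_ <= _ < _) _.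
have -> : fpsC ((1 + - lmon 1 * lmon (-3)) * (1 + - lmon 1 * lmon 1) * (- lmon 1) ^+ N)
  = (1 - v ^+ 2) * (1 - u ^+ 2) * (- u) ^+ N.
  rewrite !fpsCM fpsCX !fpsCD !fpsCM fpsC1 !fpsCN v3 -/(zpow 1).
  by have := zpow_uv; move: u v => u' v' uv; ring: uv.
have := zpow_uv; move: u v => u' v' uv.
by ring: uv.
Qed.

Lemma rank_term_small (R : comNzRingType) (x y : fps R) k :
  eqmodq k (rank_term x y k) 0.
Proof.
exists (qpoch (x ^+ 2) k * qpoch (y ^+ 2) k /
  (qpoch (- x * fpsq) k * qpoch (- y * fpsq) k)).
by rewrite /rank_term; ring.
Qed.

(** After multiplication by [z - 1 + 1/z] both sides reduce to [rank_prod], the left one by the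
    q-Gauss sum and the right one by telescoping. *)
Lemma pair_series_signed : pair_series signed_monomial = fps_sum (rank_term u v).
Proof.
apply: zpow_three_reg; apply: eqmodq_fps => K.
apply: eqmodq_trans.
  apply: eqmodqMl; apply: eqmodq_sym.
  exact: eqmodq_leq (leqnSn K) (eqmodq_bounded_rank_series _ _ _ _ _ K).
rewrite bounded_rank_gauss.
apply: (@eqmodq_trans _ _ (1 - (1 - u) * (1 - v) * rank_prod u v K.+1)).
  apply: eqmodqB; first exact: eqmodq_refl.
  apply: eqmodqMl; apply: eqmodq_leq (leqnSn K) _.
  exact: gauss_sum zpow_uv _.
rewrite -(rank_term_telescope zpow_uv); apply: eqmodqMl; apply: eqmodq_sym.
apply: (@eqmodq_leq _ _ K.+2); first by rewrite !leqW.
exact: eqmodq_fps_sum (rank_term_small _ _).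
Qed.

Lemma rank_seriesE : rank_series = qpoch_inf q * pair_series signed_monomial.
Proof.
have e2 : zpow 2 = u ^+ 2 by rewrite expr2 -zpowD.
have e2' : zpow (-2) = v ^+ 2 by rewrite expr2 -zpowD.
by rewrite pair_series_signed /rank_series e2 e2'.
Qed.

(** * From the signed count to [Nrank] *)

Lemma size_overlined s : size s = (overlined s + nonoverlined s)%N.
Proof. by rewrite -(count_predC (fun x : part => x.2) s). Qed.

Lemma size_le_weight s : overpartition s -> (size s <= weight s)%N.
Proof.
elim: s => // x s IH; rewrite overpartition_cons weight_cons /=.
by case/and3P=> x0 _ /IH; lia.
Qed.

Lemma chi_leq_largest la mu : overpartition la -> overpartition mu ->
  (chi la mu <= largest la mu)%N.
Proof.
move=> ola omu; case: (ltnP 0 (largest la mu)) => [|l0].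
  exact: leq_trans (leq_b1 _).
move: l0; rewrite largest_leq !parts_le0 // => /andP[/eqP -> /eqP ->].
by [].
Qed.

Lemma sign_eq (R : pzRingType) (a b : nat) (c : int) :
  a%:Z - b%:Z = 2 * c -> (-1) ^+ a = (-1) ^+ b :> R.
Proof.
by move=> abc; rewrite -signr_odd -[RHS]signr_odd; congr (_ ^+ nat_of_bool _); lia.
Qed.

Lemma zcoef_signed_monomial (m : int) la mu :
  overpartition la -> overpartition mu ->
  let r := (overlined la + nonoverlined mu)%N in
  let s := size mu in
  zcoef m (signed_monomial la mu) =
  (pair_rank la mu == m - 2 * s%:Z + 2 * r%:Z)%:R * (-1) ^+ `|(r%:Z + s%:Z + m)%R|%N.
Proof.
move=> ola omu r s; have chil := chi_leq_largest ola omu.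
rewrite /signed_monomial /rank_monomial /pair_monomial /ov_monomial expr1n mulr1.
set e := (_ - _)%N.
rewrite (exprNn _ e) (exprNn _ (nonoverlined la)) !lmonX.
rewrite (_ : _ * _ = (-1) ^+ (e + nonoverlined la) *
  (lmon (1 * e%:Z) * lmon (-3 * (overlined la)%:Z) *
   lmon (-1 * (nonoverlined la)%:Z) * lmon (1 * (overlined mu)%:Z))); last first.
  by rewrite exprD; ring.
rewrite -!lmonD zcoef_signM zcoef_mon mulrC.
have -> : (m == 1 * e%:Z + -3 * (overlined la)%:Z + -1 * (nonoverlined la)%:Z +
   1 * (overlined mu)%:Z) = (pair_rank la mu == m - 2 * s%:Z + 2 * r%:Z).
  by rewrite /pair_rank /s /r !size_overlined /e; lia.
case: eqP => [h|_]; last by rewrite !mul0r.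
congr (_ * _).
(* The sign exponent is an absolute value: [c] is half the difference of [e + nonoverlined la] and
   [r + s + m] when the latter is nonnegative, half their sum otherwise. *)
have [c cE] : exists c : int, (e + nonoverlined la)%N%:Z - `|(r%:Z + s%:Z + m)%R|%N%:Z = 2 * c.
  move: h; rewrite /pair_rank /s /r !size_overlined /e => h.
  case: (lerP 0 (r%:Z + s%:Z + m)) => x0.
    exists ((size la)%:Z - (size mu)%:Z).
    by move: x0; rewrite /s /r !size_overlined; lia.
  exists (e%:Z - (overlined la)%:Z + (size mu)%:Z).
  by move: x0; rewrite /s /r !size_overlined; lia.
exact: sign_eq cE.
Qed.

Lemma Nrank_sum r s m n : Nrank r s m n =
  (\sum_(la <- ovparts n) \sum_(mu <- ovparts n | weight la + weight mu == n)
   [&& pair_rank la mu == m, overlined la + nonoverlined mu == r &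
       size mu == s])%N.
Proof.
rewrite /Nrank.
pose C (p : seq part * seq part) := [&& (weight p.1 + weight p.2 == n)%N,
  pair_rank p.1 p.2 == m, (overlined p.1 + nonoverlined p.2 == r)%N &
  size p.2 == s].
have -> : (#|` fset_set (rank_pairs r s m n)|)%fset =
  size [seq p <- [seq (la, mu) | la <- ovparts n, mu <- ovparts n] | C p].
  apply/perm_size/uniq_perm; first exact: fset_uniq.
    rewrite filter_uniq // allpairs_uniq ?ovparts_uniq //.
    by move=> [? ?] [? ?].
  move=> [la mu]; rewrite mem_filter in_fset_set; last exact: rank_pairs_finite.
  apply/idP/andP.
    move=> /set_mem [[/= o1 o2 wE rE] [rE' sE]].
    split; first by rewrite /C /= wE rE rE' sE !eqxx.
    by apply: allpairs_f; rewrite mem_ovparts ?o1 ?o2 -wE ?leq_addl ?leq_addr.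
  case=> /and4P[/= /eqP w /eqP re /eqP r' /eqP s'].
  case/allpairsP=> [[la' mu']] /= [h1 h2 [e1 e2]].
  move: h1 h2; rewrite -e1 -e2 !mem_ovparts => /andP[o1 _] /andP[o2 _].
  by apply/mem_set; split=> //; split.
rewrite size_filter -sum1_count big_mkcond big_allpairs; apply: eq_bigr => la _.
rewrite [RHS]big_mkcond; apply: eq_bigr => mu _; rewrite /C /=.
by case: ifP => [/and4P[-> -> -> ->]//|]; case: ifP => //= _ ->.
Qed.

Lemma sum_delta (V : nmodType) (B a : nat) (F : nat -> V) : (a <= B)%N ->
  \sum_(0 <= i < B.+1) (if a == i then F i else 0) = F a.
Proof.
move=> aB; rewrite (bigD1_seq a) ?mem_index_iota ?iota_uniq // eqxx.
by rewrite big1 => [|i]; [exact: addr0|rewrite eq_sym => /negPf ->].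
Qed.

(** Each pair contributes to a single [(r, s)]. Both statistics count parts, so any [B >= n] bounds
    them. *)
Lemma zcoef_pair_series (m : int) (n B : nat) : (n <= B)%N ->
  zcoef m (qcoef n (pair_series signed_monomial)) =
  \sum_(0 <= r < B.+1) \sum_(0 <= s < B.+1)
     (Nrank r s (m - 2 * s%:Z + 2 * r%:Z) n)%:Z * (-1) ^+ `|(r%:Z + s%:Z + m)%R|%N.
Proof.
move=> nB; rewrite pair_seriesE zcoef_sum.
pose g la mu r s : int := ([&& pair_rank la mu == m - 2 * s%:Z + 2 * r%:Z,
  (overlined la + nonoverlined mu == r)%N & size mu == s] : nat)%:Z *
  (-1) ^+ `|(r%:Z + s%:Z + m)%R|%N.
have NE r s : (Nrank r s (m - 2 * s%:Z + 2 * r%:Z) n)%:Z *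
   (-1) ^+ `|(r%:Z + s%:Z + m)%R|%N = \sum_(la <- ovparts n)
     \sum_(mu <- ovparts n | (weight la + weight mu == n)%N) g la mu r s.
  rewrite Nrank_sum (big_morph Posz PoszD (erefl _)) mulr_suml.
  apply: eq_bigr => la _; rewrite (big_morph Posz PoszD (erefl _)) mulr_suml.
  by [].
rewrite (eq_bigr (fun r => \sum_(la <- ovparts n)
     \sum_(mu <- ovparts n | (weight la + weight mu == n)%N)
       \sum_(0 <= s < B.+1) g la mu r s)); last first.
  move=> r _; under eq_bigr => s _ do rewrite NE.
  by rewrite exchange_big; apply: eq_bigr => la _; rewrite exchange_big.
rewrite exchange_big; apply: eq_big_seq => la; rewrite mem_ovparts => /andP[ola _].
rewrite exchange_big zcoef_sum big_seq_cond [RHS]big_seq_cond.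
apply: eq_bigr => mu /andP[]; rewrite mem_ovparts => /andP[omu _] /eqP wE.
rewrite zcoef_signed_monomial //.
have rB : (overlined la + nonoverlined mu <= B)%N.
  have := size_le_weight ola; have := size_le_weight omu.
  by rewrite !size_overlined; lia.
have sB : (size mu <= B)%N.
  by rewrite (leq_trans (size_le_weight omu)) // (leq_trans _ nB) // -wE leq_addl.
rewrite -[LHS](sum_delta (fun r => (pair_rank la mu == m - 2 * (size mu)%:Z + 2 * r%:Z)%:R *
  (-1) ^+ `|(r%:Z + (size mu)%:Z + m)%R|%N) rB).
apply: eq_bigr => r _; case: eqP => [<-|ne]; last first.
  by rewrite big1 // => s _; move/eqP/negPf: ne => ne; rewrite /g ne andbF mul0r.
rewrite -[LHS](sum_delta (fun s => (pair_rank la mu == m - 2 * s%:Z +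
    2 * (overlined la + nonoverlined mu)%N%:Z)%:R *
  (-1) ^+ `|((overlined la + nonoverlined mu)%N%:Z + s%:Z + m)%R|%N) sB).
apply: eq_bigr => s _; rewrite /g eqxx /=; case: (size mu =P s) => [<-|_].
  by rewrite andbT; case: (_ == _).
by rewrite andbF mul0r.
Qed.

(** * The pentagonal number theorem and the recurrence in [m] *)

Lemma sum_sym_rev (V : nmodType) (F : int -> V) N :
  \sum_(0 <= k < N.*2.+1) F (k%:Z - N%:Z) =
  \sum_(0 <= k < N.*2.+1) F (- (k%:Z - N%:Z)).
Proof.
rewrite big_nat_rev; apply: eq_big_nat => k /andP[_ kN]; congr F.
by rewrite -addnn in kN *; lia.
Qed.

(** Reflecting the index in the first half of each term makes both halves carry the same power of
    [q]. *)
Lemma quint_term_sym (R : comNzRingType) (up : int -> fps R) N :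
  \sum_(0 <= k < N.*2.+1) quint_term up (k%:Z - N%:Z) =
  \sum_(0 <= k < N.*2.+1)
    (up (- (3 * (k%:Z - N%:Z))) - up (3 * (k%:Z - N%:Z) + 1)) *
    fpsq ^+ `|omega (k%:Z - N%:Z)|%N.
Proof.
rewrite /quint_term sumrB (sum_sym_rev (fun j => up (3 * j) * fpsq ^+ `|omega (- j)|%N)).
rewrite -sumrB; apply: eq_bigr => k _.
by rewrite opprK mulrN mulrBl.
Qed.

Lemma signzD (R : pzRingType) (x y : int) :
  (-1) ^+ `|(x + y)%R|%N = (-1) ^+ `|x|%N * (-1) ^+ `|y|%N :> R.
Proof.
rewrite -exprD -signr_odd -[RHS]signr_odd; congr (_ ^+ nat_of_bool _).
lia.
Qed.

(** At [z = -1] the quotient [rank_prod] is [1] and [1 - z] is [2], so the quintuple product becomes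
    twice Euler's identity. *)
Lemma pentagonal_trunc K :
  eqmodq K (qpoch q K) (\sum_(0 <= k < K.*2.*2.+1)
    fpsC ((-1) ^+ `|k%:Z - K.*2%:Z|%N) * q ^+ `|omega (k%:Z - K.*2%:Z)|%N).
Proof.
pose sg (x : int) : fps L := (-1) ^+ `|x|%N.
have sgD x y : sg (x + y) = sg x * sg y by exact: signzD.
have := quintuple_product (erefl : sg 0 = 1) sgD K.
rewrite quint_term_sym.
have -> : rank_prod (sg 1) (sg (-1)) K = 1.
  rewrite /rank_prod /sg expr1 sqrrN expr1n mul1r opprK mul1r divrr //.
  by rewrite unitrM !qpoch_unit.
have -> : 1 - sg 1 = 2 by rewrite /sg expr1 opprK.
rewrite mulr1 => h.
have {}h : eqmodq K (fpsC 2 * qpoch q K) (fpsC 2 * \sum_(0 <= k < K.*2.*2.+1)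
    fpsC ((-1) ^+ `|k%:Z - K.*2%:Z|%N) * q ^+ `|omega (k%:Z - K.*2%:Z)|%N).
  rewrite mulrC (_ : fpsC 2 = 2); last by rewrite fpsCD.
  apply: eqmodq_trans h _; rewrite mulr_sumr; apply: eqmodq_sum => k _.
  set j : int := k%:Z - K.*2%:Z.
  rewrite fpsCX fpsCN fpsC1 -[(-1) ^+ _]/(sg j).
  have -> : sg (- (3 * j)) = sg j by apply: (@sign_eq _ _ _ `|j|%N); lia.
  have -> : sg (3 * j + 1) = - sg j.
    rewrite sgD {2}/sg expr1 mulrN1; congr (- _).
    by apply: (@sign_eq _ _ _ `|j|%N); lia.
  move: (sg j) (q ^+ _) => a b.
  rewrite (_ : (a - - a) * b = 2 * (a * b)); last by ring.
  exact: eqmodq_refl.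
(* The factor [2] cancels because the Laurent coefficients are integers. *)
apply/eqmodqP => i iK; have := (eqmodqP K _ _).1 h i iK; rewrite !qcoefCM => e.
apply/laurentP => k; have := congr1 (zcoef k) e.
by rewrite !mulrDl !mul1r !zcoefD; lia.
Qed.

Lemma qcoef_CqX (R : comNzRingType) n (c : R) k :
  qcoef n (fpsC c * fpsq ^+ k) = if n == k then c else 0.
Proof.
rewrite qcoefCM -[_ ^+ k]mulr1 qcoef_qXM qcoef1.
case: ltngtP => [|kn|->]; rewrite ?mulr0 ?subnn ?mulr1 //.
by rewrite subn_eq0 leqNgt kn mulr0.
Qed.

(** The window contains [l] because [|l| <= omega l], and injectivity of [omega] excludes any other
    index. *)
Lemma sum_omega (V : nmodType) (h : int -> V) (l : int) n N : (n <= N)%N ->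
  n%:Z = omega l ->
  \sum_(0 <= k < N.*2.+1)
    (if n == `|omega (k%:Z - N%:Z)|%N then h (k%:Z - N%:Z) else 0) = h l.
Proof.
move=> nN nl; have ln := omega_ge_norm l.
have kN : (`|(l + N%:Z)%R|%N <= N.*2)%N by rewrite -addnn; lia.
have lE : `|(l + N%:Z)%R|%N%:Z - N%:Z = l by lia.
rewrite -lE -(sum_delta (fun k => h (k%:Z - N%:Z)) kN).
apply: eq_bigr => k _; congr (if _ then _ else _).
apply/eqP/eqP => [e|<-]; last by rewrite lE -nl.
have : omega l = omega (k%:Z - N%:Z).
  by rewrite -nl e; have := omega_ge0 (k%:Z - N%:Z); lia.
by move/omega_inj; lia.
Qed.

(** In the telescoped form, [(q)_K] alone is the pentagonal series, while [(q)_K (1 - u) rank_prod]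
    is the quintuple product; the factor [1 - v] is left over. *)
Lemma three_rank_trunc K :
  eqmodq K ((u - 1 + v) * rank_series)
    (\sum_(0 <= k < K.*2.*2.+1)
      fpsC ((-1) ^+ `|k%:Z - K.*2%:Z|%N - (1 - lmon (-1)) *
        (lmon (- (3 * (k%:Z - K.*2%:Z))) - lmon (3 * (k%:Z - K.*2%:Z) + 1))) *
      q ^+ `|omega (k%:Z - K.*2%:Z)|%N).
Proof.
rewrite rank_seriesE pair_series_signed mulrCA.
apply: (@eqmodq_trans _ _ (qpoch q K * (1 - (1 - u) * (1 - v) * rank_prod u v K))).
  apply: (@eqmodq_leq _ _ K.+1) => //; apply: eqmodqM.
    exact: eqmodq_qpoch_inf.
  rewrite -(rank_term_telescope zpow_uv); apply: eqmodqMl.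
  exact: eqmodq_fps_sum (rank_term_small _ _).
have -> : qpoch q K * (1 - (1 - u) * (1 - v) * rank_prod u v K) =
  qpoch q K - (1 - v) * (qpoch q K * ((1 - u) * rank_prod u v K)) by ring.
have := quintuple_product zpow0 zpowD K; rewrite quint_term_sym => h.
apply: eqmodq_trans (eqmodqB (pentagonal_trunc K) (eqmodqMl (1 - v) h)) _.
rewrite mulr_sumr -sumrB; apply: eqmodq_sum => k _.
have E (c d x y : L) f : fpsC (c - (1 - d) * (x - y)) * f =
  fpsC c * f - (1 - fpsC d) * ((fpsC x - fpsC y) * f).
  by rewrite fpsCD fpsCN fpsCM !fpsCD !fpsCN fpsC1 mulrBl mulrA.
rewrite E; exact: eqmodq_refl.
Qed.

Lemma three_rank_coef (m : int) (n : nat) (l : int) : n%:Z = omega l ->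
  let c k := zcoef k (qcoef n rank_series) in
  c (m - 1) - c m + c (m + 1) =
  (-1) ^+ `|l|%N * (m == 0)%:R - (m == - (3 * l))%:R + (m == 3 * l + 1)%:R
  + (m == - (3 * l) - 1)%:R - (m == 3 * l)%:R.
Proof.
move=> nl c; rewrite /c -zcoef_three -qcoefCM -zpow_three.
rewrite ((eqmodqP n.+1 _ _).1 (three_rank_trunc n.+1) n (ltnSn n)) qcoef_sum.
under eq_bigr => k _ do rewrite qcoef_CqX.
rewrite (sum_omega (fun j => (-1) ^+ `|j|%N - (1 - lmon (-1)) *
        (lmon (- (3 * j)) - lmon (3 * j + 1))) _ nl); last by rewrite -addnn; lia.
rewrite zcoefD zcoefN mulrBl mul1r !mulrBr -!lmonD -[(-1) ^+ _]mulr1 zcoef_signM.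
rewrite -lmon0 !(zcoefD, zcoefN) !zcoef_mon.
have -> : (m == -1 + - (3 * l)) = (m == - (3 * l) - 1) by lia.
have -> : (m == -1 + (3 * l + 1)) = (m == 3 * l) by lia.
ring.
Qed.

End LaurentSpecialization.

(** * Chebyshev values at [1/2] and the solution of the recurrence *)

Lemma Uhalf_rec (n : nat) : Uhalf n.+2 = Uhalf n.+1 - Uhalf n.
Proof.
rewrite /Uhalf !absz_nat [chebU n.+2]/(2 *: 'X * chebU n.+1 - chebU n).
by rewrite hornerD hornerN hornerM hornerZ hornerX mul1r divff // mul1r.
Qed.

(** The bound on [j] keeps the indices nonnegative: [Uhalf] depends on the absolute value only, and
    the relation fails at [j = 0]. *)
Lemma UhalfS (j : int) : 1 <= j -> Uhalf (j + 1) = Uhalf j - Uhalf (j - 1).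
Proof.
case: j => // -[//|n] _.
have -> : n.+1%:Z + 1 = n.+2 by lia.
have -> : n.+1%:Z - 1 = n by lia.
exact: Uhalf_rec.
Qed.

Lemma Uhalf0 : Uhalf 0 = 1.
Proof. by rewrite /Uhalf absz_nat hornerC. Qed.

Lemma Uhalf1 : Uhalf 1 = 1.
Proof. by rewrite /Uhalf absz_nat /= hornerZ hornerX mul1r divff. Qed.

(* The solution of the recurrence in [Uimpulse_rec] that vanishes for [i <= 0]. *)
Definition Uimpulse (i : int) : rat := if 0 < i then Uhalf (i - 1) else 0.

Lemma Uimpulse_le0 i : i <= 0 -> Uimpulse i = 0.
Proof. by rewrite /Uimpulse leNgt; case: (0 < i). Qed.

Lemma Uimpulse_gt0 i : 0 < i -> Uimpulse i = Uhalf (i - 1).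
Proof. by rewrite /Uimpulse => ->. Qed.

(** For [i >= 2] this is the Chebyshev recurrence; at [i = 1] it is [U_0 = U_1], and at [i = 0] only
    [U_0 = 1] survives. *)
Lemma Uimpulse_rec i :
  Uimpulse (i - 1) - Uimpulse i + Uimpulse (i + 1) = (i == 0)%:R.
Proof.
case: (ltrgt0P i) => [i0|i0|->].
- rewrite !(@Uimpulse_gt0 i) // (@Uimpulse_gt0 (i + 1)) ?addrK; last by lia.
  have [i1|i1] := eqVneq i 1.
    by rewrite i1 subrr Uimpulse_le0 // Uhalf0 Uhalf1 sub0r addNr.
  rewrite Uimpulse_gt0; last by lia.
  have := @UhalfS (i - 1) ltac:(lia); rewrite subrK => ->.
  by rewrite /=; ring.
- by rewrite !Uimpulse_le0 ?subrr ?addr0 //; lia.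
by rewrite (@Uimpulse_le0 (0 - 1)) // (@Uimpulse_le0 0) // (@Uimpulse_gt0 (0 + 1)) // addrK Uhalf0.
Qed.

(** Neighbouring impulses differ by one Chebyshev value, which merges the five terms of
    [rank_coef_solution] into the three of the closed forms. *)
Lemma Uimpulse_addr1 i : 0 < i -> Uimpulse (i + 1) = Uimpulse i + Uhalf (i + 1).
Proof. by move=> i0; rewrite !Uimpulse_gt0 ?UhalfS ?addrK //; [ring|lia..]. Qed.

Lemma Uimpulse_subr1 i : 1 < i -> Uimpulse (i - 1) = Uimpulse i - Uhalf i.
Proof.
move=> i1; rewrite !Uimpulse_gt0; [|lia..].
by have := @UhalfS (i - 1) ltac:(lia); rewrite subrK => ->; ring.
Qed.

(** Superposition: one impulse for each source term in [three_rank_coef]. The difference of the two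
    sides solves the homogeneous recurrence and vanishes far to the left. *)
Lemma rank_coef_solution (m : int) (n : nat) (l : int) : n%:Z = omega l ->
  (zcoef m (qcoef n rank_series))%:~R =
  (-1) ^+ `|l|%N * Uimpulse m - Uimpulse (m + 3 * l) +
  Uimpulse (m - (3 * l + 1)) + Uimpulse (m + (3 * l + 1)) - Uimpulse (m - 3 * l).
Proof.
move=> nl; apply/eqP; rewrite -subr_eq0; apply/eqP.
set P := qcoef n rank_series.
pose d k : rat := (zcoef k P)%:~R - ((-1) ^+ `|l|%N * Uimpulse k - Uimpulse (k + 3 * l) +
  Uimpulse (k - (3 * l + 1)) + Uimpulse (k + (3 * l + 1)) - Uimpulse (k - 3 * l)).
apply: (@recurrence_zero _ d _ _ m).
  (* The bound [-(3 |l| + 2)] makes all five arguments of [Uimpulse] nonpositive. *)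
  have [M PM] := zcoef_far P; exists (Num.min M (- (3 * `|l| + 2))) => k.
  rewrite le_min => /andP[kM kl]; rewrite /d PM // !Uimpulse_le0; [|lia..].
  by rewrite mulr0z; ring.
move=> k; rewrite /d.
have := congr1 (fun x : int => x%:~R : rat) (three_rank_coef k nl).
rewrite -/P !(rmorphD, rmorphB, rmorphM, rmorphXn, rmorphN, rmorph1) /= !rmorph_nat => e.
have r0 := Uimpulse_rec k.
have r1 := Uimpulse_rec (k + 3 * l).
have r2 := Uimpulse_rec (k - (3 * l + 1)).
have r3 := Uimpulse_rec (k + (3 * l + 1)).
have r4 := Uimpulse_rec (k - 3 * l).
have b1 : (k + 3 * l == 0) = (k == - (3 * l)) by lia.
have b2 : (k - (3 * l + 1) == 0) = (k == 3 * l + 1) by lia.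
have b3 : (k + (3 * l + 1) == 0) = (k == - (3 * l) - 1) by lia.
have b4 : (k - 3 * l == 0) = (k == 3 * l) by lia.
have i1 : k - 1 + 3 * l = k + 3 * l - 1 by lia.
have i2 : k - 1 - (3 * l + 1) = k - (3 * l + 1) - 1 by lia.
have i3 : k - 1 + (3 * l + 1) = k + (3 * l + 1) - 1 by lia.
have i4 : k - 1 - 3 * l = k - 3 * l - 1 by lia.
have j1 : k + 1 + 3 * l = k + 3 * l + 1 by lia.
have j2 : k + 1 - (3 * l + 1) = k - (3 * l + 1) + 1 by lia.
have j3 : k + 1 + (3 * l + 1) = k + (3 * l + 1) + 1 by lia.
have j4 : k + 1 - 3 * l = k - 3 * l + 1 by lia.
rewrite i1 i2 i3 i4 j1 j2 j3 j4; clear i1 i2 i3 i4 j1 j2 j3 j4.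
rewrite -{}b1 -{}b2 -{}b3 -{}b4 -{}r0 -{}r1 -{}r2 -{}r3 -{}r4 in e.
move: e; set x := (_ %:~R); set y := (_ %:~R); set w := (_ %:~R).
move=> /eqP; rewrite -subr_eq0 => /eqP <-.
by ring.
Qed.

(** * Convolution with the pentagonal series *)

Definition sym_range (n : nat) : seq int := [seq k%:Z - n%:Z | k <- index_iota 0 n.*2.+1].

Lemma mem_sym_range n j : (j \in sym_range n) = (`|j| <= n%:Z).
Proof.
apply/mapP/idP => [[k]|jn]; first by rewrite mem_index_iota -addnn => ? ->; lia.
by exists `|(j + n%:Z)%R|%N; [rewrite mem_index_iota -addnn; lia|lia].
Qed.

Lemma sym_range_uniq n : uniq (sym_range n).
Proof. by rewrite map_inj_uniq ?iota_uniq // => i j /addIr[]. Qed.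

Lemma zcoef_rank_series (m : int) (n : nat) :
  zcoef m (qcoef n rank_series) =
  \sum_(j <- sym_range n.+1.*2) if omega j <= n%:Z then
     (-1) ^+ `|j|%N *
     zcoef m (qcoef `|n%:Z - omega j|%N (pair_series signed_monomial)) else 0.
Proof.
rewrite rank_seriesE.
have h := eqmodqMr (pair_series signed_monomial)
  (eqmodq_trans (eqmodq_leq (leqnSn n.+1) (eqmodq_qpoch_inf n.+1 (qcoef0_q _)))
     (pentagonal_trunc n.+1)).
rewrite ((eqmodqP n.+1 _ _).1 h n (ltnSn n)) mulr_suml qcoef_sum zcoef_sum big_map.
apply: eq_bigr => k _; set j : int := _ - _.
rewrite -mulrA qcoefCM qcoef_qXM.
have := omega_ge0 j => o0; have -> : (n < `|omega j|%N)%N = ~~ (omega j <= n%:Z) by lia.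
case: ifP => [/negPf ->|/negbFE jn]; first by rewrite mulr0 zcoef0.
rewrite jn zcoef_signM; congr (_ * zcoef _ (qcoef _ _)); lia.
Qed.

Lemma signzE (x : int) : (-1) ^ x = (-1) ^+ `|x|%N :> int.
Proof. by case: x => n //; rewrite NegzE -exprz_inv invrN1. Qed.

(** Both [r] and [s] count parts, each of size at least one. This makes the support of the sum over
    all [r], [s] finite. *)
Lemma Nrank_eq0 r s m n : ~~ (maxn r s <= n)%N -> Nrank r s m n = 0%N.
Proof.
move=> rsn; rewrite Nrank_sum big1_seq // => la /andP[_].
rewrite mem_ovparts => /andP[ola _]; rewrite big1_seq // => mu /andP[/eqP wE].
rewrite mem_ovparts => /andP[omu _].
have := size_le_weight ola; have := size_le_weight omu.
move: rsn; rewrite !size_overlined => rsn h1 h2.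
by case: (boolP [&& _, _ & _]) => // /and3P[_ /eqP ? /eqP ?]; lia.
Qed.

Lemma rank_series_Nrank (m : int) (n : nat) :
  zcoef m (qcoef n rank_series) =
  \sum_(t \in [set t : nat * nat * int | 0 <= omega t.2 <= n%:Z])
    (let: (r, s, k) := t in
     (Nrank r s (m - 2 * s%:Z + 2 * r%:Z) `|n%:Z - omega k|)%:Z *
     (-1) ^ (r%:Z + s%:Z + m + k)).
Proof.
pose G (t : nat * nat * int) : int := let: (r, s, k) := t in
     (Nrank r s (m - 2 * s%:Z + 2 * r%:Z) `|n%:Z - omega k|)%:Z *
     (-1) ^ (r%:Z + s%:Z + m + k).
pose I := index_iota 0 n.+1.
pose J := [seq j <- sym_range n.+1.*2 | omega j <= n%:Z].
have memI r : (r \in I) = (r <= n)%N by rewrite mem_index_iota.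
have memJ j : (j \in J) = (omega j <= n%:Z).
  rewrite mem_filter mem_sym_range; have := omega_ge_norm j.
  by rewrite -addnn; case: (boolP (omega j <= n%:Z)) => //=; lia.
have uJ : uniq J by rewrite filter_uniq ?sym_range_uniq.
have uI : uniq I by exact: iota_uniq.
have big_J F : \sum_(j <- J) F j =
  \sum_(j <- sym_range n.+1.*2) if omega j <= n%:Z then F j else 0 :> int.
  by rewrite big_filter big_mkcond.
rewrite zcoef_rank_series -big_J -/G.
move: J memJ uJ {big_J} => J memJ uJ.
(* A finite box containing the support; the bound [n] on [r] and [s] is uniform in [k], as
   [n - omega k <= n]. *)
pose S := [seq (x, k) | x <- [seq (r, s) | r <- I, s <- I], k <- J].
have uS : uniq S.
  rewrite allpairs_uniq //; last by move=> [? ?] [? ?].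
  by rewrite allpairs_uniq // => -[? ?] [? ?].
have -> : \sum_(t \in [set t : nat * nat * int | 0 <= omega t.2 <= n%:Z]) G t =
   \sum_(t <- S) G t.
  rewrite (fsbig_seq _ _ uS); apply/esym/fsbig_widen.
    move=> t /= /allpairsP[[x k]] /= [_]; rewrite memJ => kn ->.
    by rewrite omega_ge0.
  move=> [[r s] k] [/= /andP[o0 kn] nS].
  rewrite /G Nrank_eq0 ?mul0r //; rewrite -ltnNge.
  have [rn|rn] := leqP r n; last by lia.
  have [sn|sn] := leqP s n; last by lia.
  exfalso; apply: nS; apply: allpairs_f; last by rewrite memJ.
  by apply: allpairs_f; rewrite memI.
rewrite big_allpairs exchange_big; apply: eq_big_seq => j; rewrite memJ => jn.
rewrite big_allpairs (@zcoef_pair_series _ _ n) ?mulr_sumr; last first.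
  by have := omega_ge0 j; lia.
apply: eq_bigr => r _; rewrite mulr_sumr; apply: eq_bigr => s _.
by rewrite /G mulrCA signzE (signzD _ (r%:Z + s%:Z + m) j) [(-1) ^+ `|j|%N * _]mulrC.
Qed.

Theorem theorem1p4 (m : int) (n : nat) :
  let c : int := zcoef m (qcoef n rank_series) in
  [/\ c = \sum_(t \in [set t : nat * nat * int | 0 <= omega t.2 <= n%:Z])
            (let: (r, s, k) := t in
             (Nrank r s (m - 2 * s%:Z + 2 * r%:Z) `|n%:Z - omega k|)%:Z *
             (-1) ^ (r%:Z + s%:Z + m + k)),
      forall l : nat, n%:Z = omega l%:Z ->
        (m < - (3 * l%:Z) -> c%:~R = 0 :> rat) /\
        (m = - (3 * l%:Z) -> c%:~R = Uhalf 1) /\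
        (- (3 * l%:Z) < m < 1 -> c%:~R = Uhalf (m + 3 * l%:Z + 1)) /\
        (1 <= m < 3 * l%:Z + 1 ->
           c%:~R = Uhalf (m + 3 * l%:Z + 1) + (-1) ^+ l * Uhalf (m - 1)) /\
        (m = 3 * l%:Z + 1 ->
           c%:~R = - Uhalf 1 + Uhalf (6 * l%:Z + 2)
                   + (-1) ^+ l * Uhalf (3 * l%:Z)) /\
        (3 * l%:Z + 1 < m ->
           c%:~R = - Uhalf (m - 3 * l%:Z) + Uhalf (m + 3 * l%:Z + 1)
                   + (-1) ^+ l * Uhalf (m - 1))
    & forall l : nat, (1 <= l)%N -> n%:Z = omega (- l%:Z) ->
        (m <= - (3 * l%:Z) -> c%:~R = 0 :> rat) /\
        (m = - (3 * l%:Z) + 1 -> c%:~R = - Uhalf 1) /\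
        (- (3 * l%:Z) + 1 < m < 1 -> c%:~R = - Uhalf (m + 3 * l%:Z)) /\
        (1 <= m < 3 * l%:Z ->
           c%:~R = - Uhalf (m + 3 * l%:Z) + (-1) ^+ l * Uhalf (m - 1)) /\
        (m = 3 * l%:Z ->
           c%:~R = - Uhalf (6 * l%:Z) + Uhalf 1
                   + (-1) ^+ l * Uhalf (3 * l%:Z - 1)) /\
        (3 * l%:Z + 1 <= m ->
           c%:~R = - Uhalf (m + 3 * l%:Z) + Uhalf (m - 3 * l%:Z + 1)
                   + (-1) ^+ l * Uhalf (m - 1))].
Proof.
move=> c; split; first exact: rank_series_Nrank.
(* The impulses at [m + 3l] and [m + 3l + 1] merge into [U_(m+3l+1)], those at [m - 3l - 1] and
   [m - 3l] into [-U_(m-3l)]; the range of [m] decides which arguments are positive. *)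
- move=> l nl; have := rank_coef_solution m nl; rewrite -/c absz_nat => ->.
  set x : int := l%:Z.
  have x0 : 0 <= x by [].
  have -> : m + (3 * x + 1) = m + 3 * x + 1 by lia.
  split=> [m1|]; first by rewrite !Uimpulse_le0; [ring|lia..].
  split=> [m1|].
    (* A single impulse is active; its value is [U_0], equal to the stated [U_1]. *)
    rewrite (@Uimpulse_gt0 (m + 3 * x + 1)) ?Uimpulse_le0; [|lia..].
    by rewrite m1 addNr add0r subrr Uhalf0 Uhalf1; ring.
  split=> [m1|].
    rewrite Uimpulse_addr1; last by lia.
    by rewrite (@Uimpulse_le0 m) ?(@Uimpulse_le0 (m - _)); [ring|lia..].
  split=> [m1|].
    by rewrite Uimpulse_addr1 ?(@Uimpulse_le0 (m - _)) ?(@Uimpulse_gt0 m); [ring|lia..].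
  split=> [m1|m1].
    rewrite Uimpulse_addr1 ?(@Uimpulse_le0 (m - (3 * x + 1))); [|lia..].
    rewrite (@Uimpulse_gt0 (m - 3 * x)) ?(@Uimpulse_gt0 m); [|lia..].
    have -> : m - 3 * x - 1 = 0 by lia.
    have -> : m - 1 = 3 * x by lia.
    have -> : m + 3 * x + 1 = 6 * x + 2 by lia.
    by rewrite Uhalf0 Uhalf1; ring.
  have -> : m - (3 * x + 1) = m - 3 * x - 1 by lia.
  rewrite Uimpulse_addr1 ?Uimpulse_subr1 ?(@Uimpulse_gt0 m); [|lia..].
  by ring.
(* For the index [-l] the shifts change sign: the pairs now give [-U_(m+3l)] and [U_(m-3l+1)]. *)
move=> l l1 nl; have := rank_coef_solution m nl; rewrite -/c abszN absz_nat => ->.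
set x : int := l%:Z.
have x0 : 1 <= x by rewrite /x; lia.
have -> : m + (3 * - x + 1) = m - 3 * x + 1 by lia.
have -> : m - (3 * - x + 1) = m + 3 * x - 1 by lia.
have -> : m - 3 * - x = m + 3 * x by lia.
have -> : m + 3 * - x = m - 3 * x by lia.
split=> [m1|]; first by rewrite !Uimpulse_le0; [ring|lia..].
split=> [m1|].
  rewrite (@Uimpulse_gt0 (m + 3 * x)) ?Uimpulse_le0; [|lia..].
  have -> : m + 3 * x - 1 = 0 by lia.
  by rewrite Uhalf0 Uhalf1; ring.
split=> [m1|].
  rewrite Uimpulse_subr1; last by lia.
  by rewrite (@Uimpulse_le0 m) ?(@Uimpulse_le0 (m - _)) ?(@Uimpulse_le0 (m - _ + 1)); [ring|lia..].
split=> [m1|].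
  rewrite Uimpulse_subr1 ?(@Uimpulse_gt0 m); [|lia..].
  by rewrite (@Uimpulse_le0 (m - _)) ?(@Uimpulse_le0 (m - _ + 1)); [ring|lia..].
split=> [m1|m1].
  rewrite Uimpulse_subr1 ?(@Uimpulse_gt0 m) ?(@Uimpulse_le0 (m - _)); [|lia..].
  rewrite (@Uimpulse_gt0 (m - _ + 1)); last by lia.
  have -> : m - 3 * x + 1 - 1 = 0 by lia.
  have -> : m - 1 = 3 * x - 1 by lia.
  have -> : m + 3 * x = 6 * x by lia.
  by rewrite Uhalf0 Uhalf1; ring.
rewrite Uimpulse_addr1 ?Uimpulse_subr1 ?(@Uimpulse_gt0 m); [|lia..].
by ring.
Qed.
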